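(* Let $p_1=2<p_2=3<\cdots$ denote the primes in increasing order, let $l_j:=p_{j+1}^2-p_j^2$ and $\tilde\pi_j := l_j\prod_{i=1}^{j}\left(1-\frac{1}{p_i}\right)$ for $j\ge1$. For real $x\ge 4$, let $k$ be the integer with $p_k^2\le x<p_{k+1}^2$ and define $$\tilde\pi(x) := \sum_{j=1}^{k-1}\tilde\pi_j + \frac{x-p_k^2}{l_k}\,\tilde\pi_k.$$ Then, as $x\to\infty$, $$\tilde\pi(x)\sim 2e^{-\gamma}\,\mathrm{li}(x),$$ where $\gamma$ is the Euler--Mascheroni constant and $\mathrm{li}(x)=\int_2^x\frac{dt}{\log t}$.
   Context: $\tilde\pi(x)$ is the paper's probabilistic prime counting function, obtained by summing the heuristic expected prime counts $\tilde\pi_j$ of the intervals $s_j=\{p_j^2,\dots,p_{j+1}^2-1\}$ (each of length $l_j$), with a linear interpolation on the last partial interval. The notation $f\sim g$ means $f/g\to1$. *)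

(* Defs.v *)
From Stdlib Require Import Reals Lra Lia ZArith Znumtheory ClassicalEpsilon.
From Coquelicot Require Import Coquelicot.
Open Scope R_scope.

(* p : nat -> nat is the increasing enumeration of the primes, 1-indexed:
   p 1 = 2 < p 2 = 3 < ... (the value p 0 is irrelevant). *)
Definition prime_enum (p : nat -> nat) : Prop :=
  (forall i j : nat, (1 <= i)%nat -> (i < j)%nat -> (p i < p j)%nat) /\
  (forall n : nat, prime (Z.of_nat n) <-> exists j : nat, (1 <= j)%nat /\ p j = n).

Definition ell (p : nat -> nat) (j : nat) : R :=
  INR (p (S j)) ^ 2 - INR (p j) ^ 2.

Fixpoint mertens_prod (p : nat -> nat) (j : nat) : R :=
  match j with
  | O => 1
  | S j' => mertens_prod p j' * (1 - / INR (p (S j')))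
  end.

Definition pit_j (p : nat -> nat) (j : nat) : R := ell p j * mertens_prod p j.

Fixpoint pit_sum (p : nat -> nat) (n : nat) : R :=
  match n with
  | O => 0
  | S n' => pit_sum p n' + pit_j p (S n')
  end.

(* the integer k >= 1 with p_k^2 <= x < p_{k+1}^2 (unique when x >= 4 and
   p enumerates the primes; chosen by Hilbert's epsilon) *)
Definition k_of (p : nat -> nat) (x : R) : nat :=
  epsilon (inhabits 0%nat)
    (fun k => (1 <= k)%nat /\ INR (p k) ^ 2 <= x < INR (p (S k)) ^ 2).

Definition pitilde (p : nat -> nat) (x : R) : R :=
  let k := k_of p x in
  pit_sum p (k - 1) + (x - INR (p k) ^ 2) / ell p k * pit_j p k.

Definition euler_gamma : R :=
  real (Lim_seq (fun n : nat =>
    sum_f_R0 (fun k => / INR (S k)) n - ln (INR (S n)))).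

Definition li (x : R) : R := RInt (fun t => / ln t) 2 x.

(* Main.v *)
Require Import Defs.
From Stdlib Require Import Reals Lra Lia ZArith Znumtheory ClassicalEpsilon.
From mathcomp Require Import all_boot zify.
From Coquelicot Require Import Coquelicot.
Open Scope R_scope.

(** Since [pitilde p] is the integral from 4 of the step function equal to
    prod_(i <= k) (1 - 1/p_i) for p_k^2 <= t < p_(k+1)^2, the theorem follows from
    Mertens' third theorem V(y) = prod_(q <= y) (1 - 1/q) ~ e^(-gamma) / ln y,
    taken at y = sqrt t.

    Only the values y = 2^m matter, by monotonicity. Chebyshev's bound and the prime
    factorization of n! give sum_(q <= 2^m) (ln q)/q = m ln 2 + O(1); summing by
    parts, T_m = - ln V(2^m) differs from the harmonic number H_m by a convergent
    sequence. Its limit c is found by an Abelian argument: with z = 2^(-s), the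
    dyadic blocks of the primes give
    sum_m (T_m - T_(m-1)) z^m = ln zeta(1+s) + o(1) = - ln s + o(1) as s -> 0+,
    while sum_m z^m/m = - ln (1 - z); so by Abel's theorem
    c = lim ln ((1 - z)/s) = ln (ln 2). Using H_m as the term of comparison is what makes
    gamma appear, as H_m - ln m -> gamma. *)

(** * Sums over primes and Chebyshev-Mertens estimates *)

(** Transfers the primality over Z used in [prime_enum] to the boolean [prime] used in all sums
    below. *)
Lemma Zprime_prime (n : nat) : Znumtheory.prime (Z.of_nat n) <-> prime n.
Proof.
split.
- move=> Hn; have := prime_ge_2 _ Hn => n2.
  apply/primeP; split; first by lia.
  move=> d /dvdnP [k Hk].
  have Hd : (Z.of_nat d | Z.of_nat n)%Z by exists (Z.of_nat k); lia.
  have [|[|[|]]] := prime_divisors _ Hn _ Hd; try lia.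
- move=> /primeP [n1 Hn]; apply/prime_alt; split; first by lia.
  move=> m Hm [k Hk].
  have Hd : (Z.to_nat m %| n)%N.
    apply/dvdnP; exists (Z.to_nat k).
    have : (0 <= k)%Z by nia.
    by nia.
  by have /orP [/eqP|/eqP] := Hn _ Hd; lia.
Qed.

(** The bound is on the size of the primes, not on their rank, so that dyadic blocks are differences
    of two values; the enumeration [p] comes back in only through [mertens_prodE]. *)
Fixpoint prime_sum (f : nat -> R) (N : nat) : R :=
  match N with
  | O => 0
  | S n => prime_sum f n + (if prime (S n) then f (S n) else 0)
  end.

Lemma prime_sumS (f : nat -> R) (n : nat) :
  prime_sum f n.+1 = prime_sum f n + (if prime n.+1 then f n.+1 else 0).
Proof. by []. Qed.

Lemma prime_sum_le (f g : nat -> R) (N : nat) :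
  (forall q, prime q -> (q <= N)%N -> f q <= g q) ->
  prime_sum f N <= prime_sum g N.
Proof.
elim: N => [|n IH] Hfg /=; first by lra.
have := IH (fun q hq hn => Hfg q hq (leqW hn)).
case: ifP => hp; last by lra.
by have := Hfg _ hp (leqnn _); lra.
Qed.

Lemma prime_sum_ext (f g : nat -> R) (N : nat) :
  (forall q, prime q -> (q <= N)%N -> f q = g q) ->
  prime_sum f N = prime_sum g N.
Proof.
move=> Hfg; apply: Rle_antisym; apply: prime_sum_le => q hq hn;
  rewrite Hfg //; lra.
Qed.

Lemma prime_sum_plus (f g : nat -> R) (N : nat) :
  prime_sum (fun q => f q + g q) N = prime_sum f N + prime_sum g N.
Proof. by elim: N => [|n IH] /=; [lra|rewrite IH; case: ifP => _; lra]. Qed.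

Lemma prime_sum_scal (c : R) (f : nat -> R) (N : nat) :
  prime_sum (fun q => c * f q) N = c * prime_sum f N.
Proof. by elim: N => [|n IH] /=; [lra|rewrite IH; case: ifP => _; lra]. Qed.

Lemma prime_sum_diff_le (f g : nat -> R) (M N : nat) :
  (M <= N)%N ->
  (forall q, prime q -> (M < q)%N -> (q <= N)%N -> f q <= g q) ->
  prime_sum f N - prime_sum f M <= prime_sum g N - prime_sum g M.
Proof.
elim: N => [|n IH] hMN Hfg.
  by move: hMN; rewrite leqn0 => /eqP ->; lra.
case: (leqP M n) => hMn; last first.
  have -> : M = n.+1 by lia.
  by lra.
have := IH hMn (fun q hq h1 h2 => Hfg q hq h1 (leqW h2)).
rewrite /=; case: ifP => hp; last by lra.
by have := Hfg _ hp hMn (leqnn _); lra.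
Qed.

Lemma prime_sum_zero (N : nat) : prime_sum (fun=> 0) N = 0.
Proof. by elim: N => [|n IH] //=; rewrite IH; case: ifP => _; lra. Qed.

Lemma prime_sum_incr (f : nat -> R) (M N : nat) :
  (M <= N)%N ->
  (forall q, prime q -> (M < q)%N -> (q <= N)%N -> 0 <= f q) ->
  prime_sum f M <= prime_sum f N.
Proof.
move=> hMN Hf; have := prime_sum_diff_le (fun=> 0) f M N hMN Hf.
by rewrite !prime_sum_zero; lra.
Qed.

Lemma prime_sum_single (f : nat -> R) (r N : nat) :
  prime r -> (r <= N)%N ->
  prime_sum (fun q => if q == r then f q else 0) N = f r.
Proof.
move=> hr; elim: N => [|n IH]; first by move/prime_gt0: hr; lia.
rewrite /=; case: (altP (n.+1 =P r)) => [e _|hne hle].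
- rewrite e hr (prime_sum_ext _ (fun=> 0)) ?prime_sum_zero; first by lra.
  by move=> q _ hq; case: eqP => // hqr; lia.
- by rewrite IH; [case: ifP => _; lra|lia].
Qed.

Lemma prime_ge2_R (q : nat) : prime q -> 2 <= INR q.
Proof. by move=> /prime_gt1 h; rewrite -[2]/(INR 2); apply: le_INR; lia. Qed.

Lemma ln_prime_ge0 (q : nat) : prime q -> 0 <= ln (INR q).
Proof.
move=> /prime_ge2_R h; rewrite -ln_1; apply: ln_le; lra.
Qed.

(** Strong induction, removing the least prime factor [pdiv m], which changes one exponent by 1. The
    free bound [N] lets several [m] share one range of summation. *)
Lemma ln_prime_factors (N m : nat) : (0 < m <= N)%N ->
  ln (INR m) = prime_sum (fun q => INR (logn q m) * ln (INR q)) N.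
Proof.
elim/ltn_ind: m => m IH /andP [m0 mN].
case: (ltngtP m 1%N) => [|m1|m1]; first by lia.
2: { rewrite m1 /= ln_1 (prime_sum_ext _ (fun=> 0)) ?prime_sum_zero // => q _ _.
  by rewrite logn1 /=; lra. }
have hp := pdiv_prime m1; have /dvdnP [k hk] := pdiv_dvd m.
have p2 := prime_gt1 hp.
have k0 : (0 < k)%N by case: k hk => // hk; lia.
have hkm : (k < m)%N by rewrite hk ltn_Pmulr.
have hpm : (pdiv m <= N)%N := leq_trans (pdiv_leq m0) mN.
move: hk hp p2 hpm; move: (pdiv m) => r hk hp p2 hrN.
rewrite hk mult_INR ln_mult; try (apply: lt_0_INR; lia).
rewrite IH //; last by lia.
rewrite -(prime_sum_single (fun q => ln (INR q)) r N hp hrN) -prime_sum_plus.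
apply: prime_sum_ext => q hq _.
rewrite lognM //; last by lia.
rewrite (logn_prime _ hp) plus_INR; case: eqP => _ /=; lra.
Qed.

Lemma ln_fact_prime_sum (N n : nat) : (n <= N)%N ->
  ln (INR n`!) = prime_sum (fun q => INR (logn q n`!) * ln (INR q)) N.
Proof.
elim: n => [|n IH] hn.
  rewrite fact0 /= ln_1 (prime_sum_ext _ (fun=> 0)) ?prime_sum_zero // => q _ _.
  by rewrite logn1 /=; lra.
have f0 := fact_gt0 n.
rewrite factS mult_INR ln_mult; try (apply: lt_0_INR; lia).
rewrite IH; last by lia.
rewrite (ln_prime_factors N) -?prime_sum_plus; last by lia.
apply: prime_sum_ext => q hq _; rewrite lognM // plus_INR; lra.
Qed.

Lemma logn_fact_lower (q n : nat) : prime q -> (n %/ q <= logn q n`!)%N.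
Proof.
move=> hq; rewrite logn_fact //; case: n => [|n]; first by rewrite div0n.
by rewrite big_ltn // expn1 leq_addr.
Qed.

(** Legendre's sum is dominated by the geometric series n/q + n/q^2 + ... = n/(q-1). *)
Lemma logn_fact_upper (q n : nat) : prime q -> (q.-1 * logn q n`! <= n)%N.
Proof.
move=> hq; rewrite logn_fact //.
have q1 := prime_gt1 hq.
(* Keeping the last quotient B = n %/ q^K makes the induction close: one more step replaces B by
   (q-1)(B %/ q) + B %/ q, which is at most B. *)
suff H K : (q.-1 * (\sum_(1 <= k < K.+1) n %/ q ^ k) + n %/ q ^ K <= n)%N.
  exact: leq_trans (leq_addr _ _) (H n).
elim: K => [|K IH]; first by rewrite big_geq // expn0 divn1; lia.
rewrite big_nat_recr //= expnSr divnMA.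
have := leq_divM (n %/ q ^ K) q.
move: IH; move: (\sum_(1 <= k < K.+1) _) (n %/ q ^ K)%N => A B IH.
by move: (B %/ q)%N => C hC; nia.
Qed.

Lemma logn_fact_small (q n : nat) : (n < q)%N -> logn q n`! = 0%N.
Proof.
move=> hn; case hq: (prime q); last by rewrite lognE hq.
rewrite logn_fact // big1_seq // => k /andP [_].
rewrite mem_index_iota => /andP [k1 _]; apply: divn_small.
by apply: (leq_trans hn); rewrite -{1}(expn1 q) leq_exp2l // prime_gt1.
Qed.

Lemma logn_central_bin (q n : nat) :
  (2 * logn q n`! <= logn q (2 * n)`!)%N.
Proof.
have := @bin_fact (2 * n) n; have -> : (2 * n - n = n)%N by lia.
move=> <-; last by lia.
have h0 := fact_gt0 n.
have hC : (0 < 'C(2 * n, n))%N by rewrite bin_gt0; lia.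
by rewrite !lognM ?muln_gt0 ?hC ?h0 //; lia.
Qed.

Lemma ln_ge_1_sub_inv (x : R) : 0 < x -> 1 - / x <= ln x.
Proof.
move=> hx; have := exp_ineq1_le (- ln x).
rewrite exp_Ropp exp_ln //; lra.
Qed.

Lemma ln_le_sub_1 (x : R) : 0 < x -> ln x <= x - 1.
Proof.
by move=> hx; have := exp_ineq1_le (ln x); rewrite exp_ln //; lra.
Qed.

Lemma ln_fact_le (n : nat) : (0 < n)%N ->
  ln (INR n`!) <= INR n * ln (INR n).
Proof.
elim: n => [//|[|n] IH] _; first by rewrite /= ln_1; lra.
have {}IH := IH isT.
rewrite factS mult_INR ln_mult; try (apply: lt_0_INR; have := fact_gt0 n.+1; lia).
have h1 : 0 < INR n.+1 by apply: lt_0_INR; lia.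
have : ln (INR n.+1) <= ln (INR n.+2) by apply: ln_le => //; rewrite (S_INR n.+1); lra.
move: IH => hf hl; have := Rmult_le_compat_l _ _ _ (Rlt_le _ _ h1) hl.
by move: hf; rewrite [INR n.+2 * _](_ : _ = (INR n.+1 + 1) * ln (INR n.+2)) ?(S_INR n.+1) //; lra.
Qed.

(** A weak Stirling bound; the induction rests on n ln ((n+1)/n) <= 1. *)
Lemma ln_fact_ge (n : nat) : (0 < n)%N ->
  INR n * ln (INR n) - INR n <= ln (INR n`!).
Proof.
elim: n => [//|[|n] IH] _; first by rewrite /= ln_1; lra.
have {}IH := IH isT.
rewrite factS mult_INR ln_mult; try (apply: lt_0_INR; have := fact_gt0 n.+1; lia).
have h1 : 0 < INR n.+1 by apply: lt_0_INR; lia.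
have : INR n.+1 * (ln (INR n.+2) - ln (INR n.+1)) <= 1.
  rewrite -ln_div; [|by rewrite (S_INR n.+1); lra|by []].
  have h2 : 0 < INR n.+2 / INR n.+1.
    by apply: Rdiv_lt_0_compat => //; rewrite (S_INR n.+1); lra.
  have := ln_le_sub_1 _ h2.
  have -> : INR n.+2 / INR n.+1 - 1 = / INR n.+1.
    by rewrite (S_INR n.+1); field; lra.
  move=> h; apply: Rle_trans (Rmult_le_compat_l _ _ _ (Rlt_le _ _ h1) h) _.
  by rewrite Rinv_r; lra.
rewrite (S_INR n.+1); lra.
Qed.

(** The bound 4^n for the central binomial coefficient, by induction from (2n+1)(2n+2) <=
    4(n+1)^2. *)
Lemma ln_central_bin_le (n : nat) :
  ln (INR (2 * n)`!) - 2 * ln (INR n`!) <= 2 * INR n * ln 2.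
Proof.
elim: n => [|n IH]; first by rewrite /= ln_1; lra.
have -> : (2 * n.+1 = (2 * n).+2)%N by lia.
rewrite !factS !mult_INR.
have f1 : 0 < INR n`! by apply: lt_0_INR; have := fact_gt0 n; lia.
have f2 : 0 < INR (2 * n)`! by apply: lt_0_INR; have := fact_gt0 (2 * n); lia.
have hn := pos_INR n.
have e1 : INR (2 * n).+1 = 2 * INR n + 1.
  by rewrite S_INR mult_INR /=; lra.
have e2 : INR (2 * n).+2 = 2 * (INR n + 1).
  by rewrite S_INR e1; lra.
rewrite e1 e2 S_INR !ln_mult; try nra.
have : ln (2 * INR n + 1) <= ln (2 * (INR n + 1)) by apply: ln_le; lra.
rewrite ln_mult; lra.
Qed.

(** Chebyshev's argument: every prime in (n, 2n] divides the central binomial coefficient, whose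
    logarithm is at most 2n ln 2. *)
Lemma theta_double (n : nat) :
  prime_sum (fun q => ln (INR q)) (2 * n) - prime_sum (fun q => ln (INR q)) n
  <= 2 * INR n * ln 2.
Proof.
apply: Rle_trans (ln_central_bin_le n).
rewrite (ln_fact_prime_sum (2 * n) (2 * n)) // (ln_fact_prime_sum (2 * n) n); last by lia.
rewrite -prime_sum_scal.
(* [g q] is the contribution of q to the logarithm of the central binomial coefficient; it is
   nonnegative, and at least ln q when n < q <= 2n. *)
pose g q := (INR (logn q (2 * n)`!) - 2 * INR (logn q n`!)) * ln (INR q).
have -> : prime_sum (fun q => INR (logn q (2 * n)`!) * ln (INR q)) (2 * n) -
  prime_sum (fun q => 2 * (INR (logn q n`!) * ln (INR q))) (2 * n)
  = prime_sum g (2 * n).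
  have := prime_sum_plus g (fun q => 2 * (INR (logn q n`!) * ln (INR q))) (2 * n).
  rewrite (prime_sum_ext _ (fun q => INR (logn q (2 * n)`!) * ln (INR q))); first by lra.
  by move=> q _ _; rewrite /g; lra.
have g0 q : prime q -> 0 <= g q.
  move=> hq; apply: Rmult_le_pos; last exact: ln_prime_ge0.
  have : INR (2 * logn q n`!) <= INR (logn q (2 * n)`!).
    by apply: le_INR; have := logn_central_bin q n; lia.
  by rewrite mult_INR /=; lra.
have hn : 0 <= prime_sum g n.
  by rewrite -(prime_sum_zero n); apply: prime_sum_le => q hq _; apply: g0.
suff : prime_sum (fun q => ln (INR q)) (2 * n) - prime_sum (fun q => ln (INR q)) n
  <= prime_sum g (2 * n) - prime_sum g n by lra.
apply: prime_sum_diff_le; first by lia.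
move=> q hq h1 h2; rewrite /g (logn_fact_small q n) // [INR 0]/=.
have : 1 <= INR (logn q (2 * n)`!).
  rewrite -[1]/(INR 1); apply: le_INR.
  have := logn_fact_lower q (2 * n) hq.
  have : (0 < 2 * n %/ q)%N by rewrite divn_gt0 // prime_gt0.
  by lia.
have := ln_prime_ge0 q hq; nra.
Qed.

Lemma INR_pow2 (m : nat) : INR (2 ^ m) = 2 ^ m.
Proof. by elim: m => [//|m IH]; rewrite expnS mult_INR IH [INR 2]/=. Qed.

Lemma ln2_pos : 0 < ln 2.
Proof. rewrite -ln_1; apply: ln_increasing; lra. Qed.

(** Chebyshev's bound along powers of 2: the gains of successive doublings form a geometric sum. *)
Lemma theta_pow2 (m : nat) :
  prime_sum (fun q => ln (INR q)) (2 ^ m) <= 2 * 2 ^ m * ln 2.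
Proof.
have h := ln2_pos; elim: m => [|m IH]; first by rewrite expn0 /=; lra.
have := theta_double (2 ^ m); rewrite -expnS INR_pow2 /=; lra.
Qed.

Lemma ln_square_tail (N : nat) :
  prime_sum (fun q => ln (INR q) * / (INR q * (INR q - 1))) N <= 2.
Proof.
(* The terms telescope against [(ln x + 2) / x]. *)
suff H n : prime_sum (fun q => ln (INR q) * / (INR q * (INR q - 1))) n.+1
    <= 2 - (ln (INR n.+1) + 2) * / INR n.+1.
  case: N => [|n]; first by rewrite /=; lra.
  apply: Rle_trans (H n) _.
  have h1 : 1 <= INR n.+1 by rewrite S_INR; have := pos_INR n; lra.
  have h2 : 0 <= ln (INR n.+1) by rewrite -ln_1; apply: ln_le; lra.
  have : 0 <= / INR n.+1 by apply: Rlt_le; apply: Rinv_0_lt_compat; lra.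
  by nra.
elim: n => [|n IH]; first by rewrite /= ln_1; lra.
set x := INR n.+1 in IH *.
have hx : 1 <= x by rewrite /x S_INR; have := pos_INR n; lra.
have ex : INR n.+2 = x + 1 by rewrite (S_INR n.+1).
have key : ln (x + 1) * / ((x + 1) * (x + 1 - 1)) <=
   (ln x + 2) * / x - (ln (x + 1) + 2) * / (x + 1).
  have hl : ln (x + 1) - ln x <= / x.
    rewrite -ln_div; try lra.
    have h2 : 0 < (x + 1) / x by apply: Rdiv_lt_0_compat; lra.
    have := ln_le_sub_1 _ h2.
    by have -> : (x + 1) / x - 1 = / x by field; lra.
  have hi : 0 < / x by apply: Rinv_0_lt_compat; lra.
  have hi1 : 0 < / (x * (x + 1)) by apply: Rinv_0_lt_compat; nra.
  have -> : (ln x + 2) * / x - (ln (x + 1) + 2) * / (x + 1) =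
    ((ln x + 2) * (x + 1) - (ln (x + 1) + 2) * x) * / (x * (x + 1)).
    by field; lra.
  have -> : / ((x + 1) * (x + 1 - 1)) = / (x * (x + 1)) by field; lra.
  apply: Rmult_le_compat_r; first by lra.
  have : x * (ln (x + 1) - ln x) <= 1.
    by apply: Rle_trans (Rmult_le_compat_l x _ _ _ hl) _; [lra|rewrite Rinv_r; lra].
  have : / x <= 1 by rewrite -Rinv_1; apply: Rinv_le_contravar; lra.
  by nra.
have pos : 0 <= ln (x + 1) * / ((x + 1) * (x + 1 - 1)).
  apply: Rmult_le_pos; first by rewrite -ln_1; apply: ln_le; lra.
  by apply: Rlt_le; apply: Rinv_0_lt_compat; nra.
rewrite prime_sumS ex.
by case: ifP => _; lra.
Qed.

(** Compares ln N! <= N ln N with its prime factorization. Since N/q <= 1 + [logn q N!], replacing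
    the exponent by N/q costs at most ln q per prime, in total O(N) by [theta_pow2]. *)
Lemma mertens1_upper (m : nat) :
  prime_sum (fun q => ln (INR q) * / INR q) (2 ^ m) <= INR m * ln 2 + 2 * ln 2.
Proof.
set N := (2 ^ m)%N.
have N0 : (0 < N)%N by rewrite /N expn_gt0.
have eN : INR N = 2 ^ m by rewrite /N INR_pow2.
have NR : 0 < INR N by apply: lt_0_INR; lia.
have := ln_fact_le N N0.
rewrite {2}eN ln_pow; last by lra.
have := theta_pow2 m; rewrite -/N -eN => hth.
rewrite (ln_fact_prime_sum N N) // => hf.
have : prime_sum (fun q => INR N * (ln (INR q) * / INR q)) N <=
  prime_sum (fun q => ln (INR q) + INR (logn q N`!) * ln (INR q)) N.
  apply: prime_sum_le => q hq _.
  have q2 := prime_ge2_R q hq; have l0 := ln_prime_ge0 q hq.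
  suff : INR N * / INR q <= 1 + INR (logn q N`!) by nra.
  have : INR N <= (1 + INR (logn q N`!)) * INR q.
    rewrite -[1]/(INR 1) -plus_INR -mult_INR; apply: le_INR.
    have := logn_fact_lower q N hq; have := divn_eq N q.
    have := ltn_pmod N (prime_gt0 hq).
    by move: (N %/ q)%N (N %% q)%N (logn _ _) => a b c; nia.
  move=> h; apply: (Rmult_le_reg_r (INR q)); first by lra.
  by rewrite Rmult_assoc Rinv_l; lra.
rewrite prime_sum_plus prime_sum_scal => h.
apply: (Rmult_le_reg_l (INR N)) => //.
lra.
Qed.

(** Here the exponent of q in N! is at most N/(q-1), and 1/(q-1) = 1/q + 1/(q(q-1)). The constant 3
    is 1 from [ln_fact_ge] plus 2 from [ln_square_tail]. *)
Lemma mertens1_lower (m : nat) :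
  INR m * ln 2 - 3 <= prime_sum (fun q => ln (INR q) * / INR q) (2 ^ m).
Proof.
set N := (2 ^ m)%N.
have N0 : (0 < N)%N by rewrite /N expn_gt0.
have eN : INR N = 2 ^ m by rewrite /N INR_pow2.
have NR : 0 < INR N by apply: lt_0_INR; lia.
have := ln_fact_ge N N0.
rewrite {2}eN ln_pow; last by lra.
rewrite (ln_fact_prime_sum N N) // => hf.
have : prime_sum (fun q => INR (logn q N`!) * ln (INR q)) N <=
  prime_sum (fun q => INR N * (ln (INR q) * / INR q
      + ln (INR q) * / (INR q * (INR q - 1)))) N.
  apply: prime_sum_le => q hq _.
  have q2 := prime_ge2_R q hq; have l0 := ln_prime_ge0 q hq.
  have -> : INR N * (ln (INR q) * / INR q + ln (INR q) * / (INR q * (INR q - 1)))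
    = INR N * / (INR q - 1) * ln (INR q) by field; lra.
  apply: Rmult_le_compat_r => //.
  apply: (Rmult_le_reg_l (INR q - 1)); first by lra.
  have -> : (INR q - 1) * (INR N * / (INR q - 1)) = INR N by field; lra.
  have -> : INR q - 1 = INR q.-1.
    by rewrite -{1}(prednK (prime_gt0 hq)) S_INR; lra.
  rewrite -mult_INR; apply: le_INR; have := logn_fact_upper q N hq; lia.
rewrite prime_sum_scal prime_sum_plus => h.
have := ln_square_tail N => ht.
apply: (Rmult_le_reg_l (INR N)) => //.
nra.
Qed.

(** * Dyadic blocks of primes *)

(** Minus the logarithm of the factor of V at q, so that V(N) = [exp (- prime_sum euler_weight N)]
    and T_m = [prime_sum euler_weight (2 ^ m)] exactly. *)
Definition euler_weight (q : nat) : R := - ln (1 - / INR q).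

Lemma prime_inv_bounds (q : nat) : prime q -> 0 < / INR q <= / 2.
Proof.
move=> /prime_ge2_R h; split; first by apply: Rinv_0_lt_compat; lra.
by apply: Rinv_le_contravar; lra.
Qed.

Lemma euler_weight_bounds (q : nat) : prime q ->
  / INR q <= euler_weight q <= / INR q + / (INR q * (INR q - 1)).
Proof.
move=> hq; have h2 := prime_ge2_R q hq; have hi := prime_inv_bounds q hq.
have hp : 0 < 1 - / INR q by lra.
rewrite /euler_weight; split; first by have := ln_le_sub_1 _ hp; lra.
have := ln_ge_1_sub_inv _ hp.
have -> : 1 - / (1 - / INR q) = - (/ INR q + / (INR q * (INR q - 1))).
  by field; lra.
lra.
Qed.

Lemma euler_weight_ge0 (q : nat) : prime q -> 0 <= euler_weight q.
Proof.
by move=> hq; have := euler_weight_bounds q hq; have := prime_inv_bounds q hq; lra.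
Qed.

Lemma sum_n_telescope (u : nat -> R) (n : nat) :
  sum_n (fun k => u k.+1 - u k) n = u n.+1 - u 0%N.
Proof.
elim: n => [|n IH]; first by rewrite sum_O.
by rewrite sum_Sn IH /plus /=; lra.
Qed.

Lemma is_series_telescope (u : nat -> R) (l : R) : is_lim_seq u l ->
  is_series (fun k => u k.+1 - u k) (l - u 0%N).
Proof.
move=> hu; change (is_lim_seq (sum_n (fun k => u k.+1 - u k)) (l - u 0%N)).
apply: (is_lim_seq_ext (fun n => u n.+1 - u 0%N)).
  by move=> n; rewrite sum_n_telescope.
apply: is_lim_seq_minus'; last exact: is_lim_seq_const.
exact: (proj1 (is_lim_seq_incr_1 _ _) hu).
Qed.

Lemma is_lim_seq_inv_n (k : nat) : is_lim_seq (fun n => / (INR n + INR k)) 0.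
Proof.
apply: (is_lim_seq_inv _ p_infty) => //.
apply: (is_lim_seq_plus _ _ p_infty (INR k) p_infty) => //.
- exact: is_lim_seq_INR.
- exact: is_lim_seq_const.
Qed.

Lemma ex_series_inv_diff : ex_series (fun n => / (INR n + 1) - / (INR n + 2)).
Proof.
have h := is_series_telescope (fun n => / (INR n + INR 1)) 0 (is_lim_seq_inv_n 1).
have := ex_series_opp _ (ex_intro _ _ h); apply: ex_series_ext => n.
by rewrite /opp S_INR /= (_ : INR n + 1 + 1 = INR n + 2); lra.
Qed.

(** This is T_(m+1) - T_m: block m is to be compared with 1/(m+1), and carries z^(m+1) in the
    generating series. *)
Definition block_weight (m : nat) : R :=
  prime_sum euler_weight (2 ^ m.+1) - prime_sum euler_weight (2 ^ m).

Lemma pow2_le (m : nat) : (2 ^ m <= 2 ^ m.+1)%N.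
Proof. by rewrite leq_exp2l. Qed.

Lemma ln_block (m q : nat) : (2 ^ m < q)%N -> (q <= 2 ^ m.+1)%N ->
  INR m * ln 2 <= ln (INR q) <= (INR m + 1) * ln 2.
Proof.
move=> h1 h2.
have p0 : 0 < 2 ^ m by apply: pow_lt; lra.
have e1 : 2 ^ m <= INR q by rewrite -INR_pow2; apply: le_INR; lia.
have e2 : INR q <= 2 ^ m.+1 by rewrite -INR_pow2; apply: le_INR; lia.
rewrite -S_INR -!ln_pow; try lra; split; apply: ln_le; lra.
Qed.

(** The sum of Mertens' first theorem with 1/q replaced by [euler_weight q], which makes its
    increments directly comparable with [block_weight]. *)
Definition weighted_theta (m : nat) : R :=
  prime_sum (fun q => euler_weight q * ln (INR q)) (2 ^ m).

Lemma weighted_theta_bound (m : nat) :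
  Rabs (weighted_theta m - INR m * ln 2) <= 4 + 2 * ln 2.
Proof.
have h2 := ln2_pos.
have hU := mertens1_upper m; have hL := mertens1_lower m.
have : prime_sum (fun q => ln (INR q) * / INR q) (2 ^ m) <= weighted_theta m.
  apply: prime_sum_le => q hq _; rewrite Rmult_comm.
  apply: Rmult_le_compat_r; first exact: ln_prime_ge0.
  by case: (euler_weight_bounds q hq).
have : weighted_theta m <= prime_sum (fun q => ln (INR q) * / INR q
      + ln (INR q) * / (INR q * (INR q - 1))) (2 ^ m).
  apply: prime_sum_le => q hq _; rewrite -Rmult_plus_distr_l Rmult_comm.
  apply: Rmult_le_compat_l; first exact: ln_prime_ge0.
  by case: (euler_weight_bounds q hq).
rewrite prime_sum_plus; have := ln_square_tail (2 ^ m).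
by move=> *; apply: Rabs_le; lra.
Qed.

(** On the block 2^(m+1) < q <= 2^(m+2), ln q lies between (m+1) ln 2 and (m+2) ln 2. The shift to
    [m.+1] keeps the smaller of the two positive. *)
Lemma block_weight_bounds (m : nat) :
  (weighted_theta m.+2 - weighted_theta m.+1) * / ((INR m + 2) * ln 2)
    <= block_weight m.+1
    <= (weighted_theta m.+2 - weighted_theta m.+1) * / ((INR m + 1) * ln 2).
Proof.
have h2 := ln2_pos; have hm := pos_INR m.
rewrite /weighted_theta /block_weight 2!(Rmult_comm _ (/ _)) 2!Rmult_minus_distr_l.
rewrite -!prime_sum_scal.
split; apply: prime_sum_diff_le; try exact: pow2_le;
  move=> q hq q1 q2; have := ln_block _ _ q1 q2; rewrite S_INR => - [b1 b2];
  have w0 := euler_weight_ge0 q hq; rewrite -Rmult_assoc (Rmult_comm (/ _)) Rmult_assoc.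
- rewrite -{2}(Rmult_1_r (euler_weight q)); apply: Rmult_le_compat_l => //.
  have hd : 0 < (INR m + 2) * ln 2 by nra.
  apply: (Rmult_le_reg_l ((INR m + 2) * ln 2)) => //.
  by rewrite -Rmult_assoc Rinv_r; lra.
- rewrite -{1}(Rmult_1_r (euler_weight q)); apply: Rmult_le_compat_l => //.
  have hd : 0 < (INR m + 1) * ln 2 by nra.
  apply: (Rmult_le_reg_l ((INR m + 1) * ln 2)) => //.
  by rewrite -Rmult_assoc Rinv_r; lra.
Qed.

(** After a shift by one, the term is [a n * b n + r n]. The first series converges by summation by
    parts, since [b] has bounded partial sums and [a] decreases to 0; the second by comparison with
    a telescoping series. *)
Lemma ex_series_block_weight :
  ex_series (fun m => block_weight m - / (INR m + 1)).
Proof.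
apply/(ex_series_incr_1 (fun m => block_weight m - / (INR m + 1))).
have h2 := ln2_pos.
pose e m := weighted_theta m - INR m * ln 2.
have eC m : Rabs (e m) <= 4 + 2 * ln 2 := weighted_theta_bound m.
pose b n := e n.+2 - e n.+1.
pose a n := / ln 2 * / (INR n + INR 2).
have sum1 : ex_series (fun n => scal (a n) (b n)).
  apply: partial_summation_R.
  - exists (2 * (4 + 2 * ln 2)) => n; rewrite (sum_n_telescope (fun k => e k.+1)).
    rewrite /norm /= /abs /=.
    have /Rabs_le_between := eC n.+2; have /Rabs_le_between := eC 1%N.
    by move=> *; apply: Rabs_le; lra.
  - have := is_lim_seq_scal_l _ (/ ln 2) _ (is_lim_seq_inv_n 2).
    by rewrite [Rbar_mult _ _]/= Rmult_0_r.
  - have := is_series_telescope (fun n => a n) 0.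
    have -> : 0 = / ln 2 * 0 by lra.
    move=> /(_ (is_lim_seq_scal_l _ (/ ln 2) _ (is_lim_seq_inv_n 2))) h.
    have := ex_series_opp _ (ex_intro _ _ h); apply: ex_series_ext => n.
    rewrite /opp /norm /minus /= /abs /plus /opp /=.
    have hn := pos_INR n.
    have hi : / (INR n.+1 + INR 2) <= / (INR n + INR 2).
      by apply: Rinv_le_contravar; rewrite ?S_INR /=; lra.
    have i2 := Rinv_0_lt_compat _ h2.
    rewrite /a Rabs_left1; nra.
(* [r n] is the error made by freezing ln q at the upper end (n+2) ln 2 of its block. *)
pose r n := block_weight n.+1 - (weighted_theta n.+2 - weighted_theta n.+1) * / ((INR n + 2) * ln 2).
(* 8 + 5 ln 2 bounds an increment of [weighted_theta]: twice the error 4 + 2 ln 2, plus the main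
   term ln 2. *)
pose C := / ln 2 * (8 + 5 * ln 2).
have sum2 : ex_series r.
  apply: (@ex_series_le R_AbsRing R_CompleteNormedModule _ (fun n => scal C (/ (INR n + 1) - / (INR n + 2)))); last first.
    exact: ex_series_scal_l ex_series_inv_diff.
  move=> n; have [b1 b2] := block_weight_bounds n; have hn := pos_INR n.
  rewrite /norm /= /abs /= /scal /= /mult /= Rabs_right; last by rewrite /r; lra.
  set D := weighted_theta _ - weighted_theta _ in b1 b2 *.
  apply: (Rle_trans _ (/ ln 2 * D * (/ (INR n + 1) - / (INR n + 2)))).
    rewrite /r -/D; move: b1 b2; rewrite !Rinv_mult; lra.
  have hD : D <= 8 + 5 * ln 2.
    have /Rabs_le_between := eC n.+2; have /Rabs_le_between := eC n.+1.
    rewrite /e /D !S_INR; lra.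
  have hi : / (INR n + 2) <= / (INR n + 1) by apply: Rinv_le_contravar; lra.
  have i2 := Rinv_0_lt_compat _ h2.
  apply: Rmult_le_compat_r; first by lra.
  by apply: Rmult_le_compat_l; lra.
have := ex_series_plus _ _ sum1 sum2; apply: ex_series_ext => n.
have hn := pos_INR n.
rewrite /scal /plus /= /mult /= -/(INR n.+1) /r /a /b /e !S_INR [INR 0]/=.
by field; lra.
Qed.

(** * Euler's product for zeta *)

Lemma sum_n_le_series (a : nat -> R) (l : R) (N : nat) :
  (forall n, 0 <= a n) -> is_series a l -> sum_n a N <= l.
Proof.
move=> ha hl; apply: (is_lim_seq_incr_compare (sum_n a) l hl).
by move=> n; rewrite sum_Sn /plus /=; have := ha n.+1; lra.
Qed.

(** Terms between consecutive multiples of [P] vanish, so the partial sums on the right are a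
    subsequence of those on the left. *)
Lemma is_series_multiples (g : nat -> R) (P : nat) (l : R) : (0 < P)%N ->
  is_series (fun n => if (P %| n)%N then g n else 0) l ->
  is_series (fun m => g (P * m)%N) l.
Proof.
move=> hP; set h := fun n => _ => hl.
have hj M j : (j < P)%N -> sum_n h (P * M + j) = sum_n h (P * M).
  elim: j => [|j IH] hj; first by rewrite addn0.
  rewrite addnS sum_Sn IH; last by lia.
  rewrite /h ifF ?/plus /=; first by rewrite Rplus_0_r.
  rewrite -addnS; rewrite dvdn_addr ?dvdn_mulr //.
  by apply/negP => /dvdn_leq; lia.
have hM M : sum_n h (P * M) = sum_n (fun m => g (P * m)%N) M.
  elim: M => [|M IH]; first by rewrite muln0 !sum_O /h dvdn0 muln0.
  have e : (P * M.+1 = (P * M + P.-1).+1)%N by lia.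
  rewrite e !sum_Sn hj; last by lia.
  by rewrite IH -e /h dvdn_mulr.
apply: (is_lim_seq_ext (fun M => sum_n h (P * M)) _ l hM).
apply: (is_lim_seq_subseq (sum_n h) l (fun M => P * M)%N) => //.
by apply: eventually_subseq => n; nia.
Qed.

(** The sieve of Eratosthenes: [f] survives at the integers without prime factor up to [N]. *)
Fixpoint sieve (f : nat -> R) (N n : nat) : R :=
  match N with
  | O => f n
  | S M => if prime N && (N %| n)%N then 0 else sieve f M n
  end.

Section Sieve.

Variable f : nat -> R.
Hypothesis f_mul : forall a b : nat, f (a * b)%N = f a * f b.
Hypothesis f_ge0 : forall n, 0 <= f n.
Hypothesis f_0 : f 0%N = 0.
Hypothesis f_1 : f 1%N = 1.
Hypothesis f_prime : forall q, prime q -> f q < 1.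
Hypothesis f_sum : ex_series f.

Lemma sieve_bounds (N n : nat) : 0 <= sieve f N n <= f n.
Proof.
elim: N => [|N IH] /=; first by have := f_ge0 n; lra.
by case: ifP => _ //; have := f_ge0 n; lra.
Qed.

Lemma sieve_0 (N : nat) : sieve f N 0 = 0.
Proof. by have := sieve_bounds N 0; rewrite f_0; lra. Qed.

Lemma sieve_1 (N : nat) : sieve f N 1 = 1.
Proof.
elim: N => [|N IH] //=; case: ifP => // /andP [hp].
by rewrite dvdn1 => /eqP h; rewrite h in hp.
Qed.

Lemma sieve_small (N n : nat) : (1 < n <= N)%N -> sieve f N n = 0.
Proof.
move=> /andP [n1 nN].
have hp := pdiv_prime n1; have hd := pdiv_dvd n.
have : (pdiv n <= N)%N by apply: leq_trans nN; apply: pdiv_leq; lia.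
elim: N {nN} => [|N IH] h /=; first by have := prime_gt0 hp; lia.
case: ifP => // hN; apply: IH.
move: h; rewrite leq_eqVlt => /orP [/eqP e|]; last by lia.
by move: hN; rewrite -e hp hd.
Qed.

(** A prime [P] beyond [N] brings in no factor that the sieve removes, so sieving commutes with
    multiplication by [P]. *)
Lemma sieve_mul (N P n : nat) : prime P -> (N < P)%N ->
  sieve f N (P * n) = f P * sieve f N n.
Proof.
move=> hP; elim: N => [|N IH] hN /=; first exact: f_mul.
case hq: (prime N.+1) => /=; last by apply: IH; lia.
rewrite Euclid_dvdM // dvdn_prime2 // (ltn_eqF hN) /=.
by case: ifP => _; [lra|apply: IH; lia].
Qed.

(* The integers struck out by the next prime P are the multiples of P already surviving,
   so each step multiplies the sum by [1 - f P]. *)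
Lemma is_series_sieve (N : nat) :
  is_series (sieve f N) (Series f * exp (prime_sum (fun q => ln (1 - f q)) N)).
Proof.
elim: N => [|N IH]; first by rewrite /= exp_0 Rmult_1_r; apply: Series_correct.
rewrite prime_sumS; case hp: (prime N.+1); last first.
  rewrite Rplus_0_r; apply: is_series_ext IH => n /=.
  by rewrite hp.
rewrite exp_plus exp_ln; last by have := f_prime _ hp; lra.
set L := Series f * exp _ in IH *.
pose h n := if (N.+1 %| n)%N then sieve f N n else 0.
have eh : ex_series h.
  apply: (@ex_series_le R_AbsRing R_CompleteNormedModule _ f) => // n.
  rewrite /norm /= /abs /= /h; have := sieve_bounds N n.
  by case: ifP => _ hb; rewrite Rabs_right; lra.
have := is_series_multiples (sieve f N) N.+1 _ (ltn0Sn N) (Series_correct _ eh).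
move=> hm.
have : is_series (fun m => scal (f N.+1) (sieve f N m)) (scal (f N.+1) L).
  exact: is_series_scal_l.
move=> hm2.
have eL : Series h = f N.+1 * L.
  rewrite -(is_series_unique _ _ hm) -[RHS](is_series_unique _ _ hm2).
  by apply: Series_ext => n; rewrite sieve_mul.
have := is_series_minus _ _ _ _ IH (Series_correct _ eh).
have -> : plus L (opp (Series h)) = Series f * (exp (prime_sum (fun q => ln (1 - f q)) N) * (1 - f N.+1)).
  by rewrite eL /plus /opp /= /L; ring.
apply: is_series_ext => n; rewrite /= /h hp /= /plus /opp /=.
by case: ifP => _; lra.
Qed.

(** Among the integers up to N+1 only n = 1 survives. *)
Lemma sieve_partial_sum (N : nat) : sum_n (sieve f N.+1) N.+1 = 1.
Proof.
suff H k : (k <= N)%N -> sum_n (sieve f N.+1) k.+1 = 1 by apply: H.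
elim: k => [|k IH] hk.
  by rewrite sum_Sn sum_O sieve_0 sieve_1 /plus /=; lra.
rewrite sum_Sn IH; last by lia.
by rewrite sieve_small ?/plus /=; lra || lia.
Qed.

(** The sieved series is at least 1, its partial sum up to N+1, and exceeds 1 by at most the tail of
    [f] beyond N+1. *)
Lemma euler_product :
  is_lim_seq (fun N => Series f * exp (prime_sum (fun q => ln (1 - f q)) N)) 1.
Proof.
apply/is_lim_seq_incr_1.
apply: (is_lim_seq_le_le (fun=> 1) _ (fun N => 1 + (Series f - sum_n f N.+1))).
- move=> N; have hs := is_series_sieve N.+1.
  split.
    have s0 n : 0 <= sieve f N.+1 n by case: (sieve_bounds N.+1 n).
    by have := sum_n_le_series _ _ N.+1 s0 hs; rewrite sieve_partial_sum.
  (* [b] is the part struck out; its partial sum, that of [f] minus 1, is at most its total, which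
     gives the upper bound. *)
  pose b n := f n - sieve f N.+1 n.
  set L := Series f * _ in hs *.
  have hm : is_series b (Series f - L) := is_series_minus _ _ _ _ (Series_correct _ f_sum) hs.
  have b0 n : 0 <= b n by rewrite /b; have := sieve_bounds N.+1 n; lra.
  have := sum_n_le_series b _ N.+1 b0 hm.
  have -> : sum_n b N.+1 = sum_n f N.+1 - 1.
    rewrite (sum_n_ext _ (fun n => plus (f n) (scal (-1) (sieve f N.+1 n)))); last first.
      by move=> n; rewrite /b /plus /scal /= /mult /=; ring.
    rewrite sum_n_plus sum_n_scal_l sieve_partial_sum.
    by rewrite /plus /scal /= /mult /=; ring.
  lra.
- exact: is_lim_seq_const.
- have h : is_lim_seq (fun N => sum_n f N.+1) (Series f).
    by apply: (proj1 (is_lim_seq_incr_1 _ _)); exact: Series_correct f_sum.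
  have := is_lim_seq_plus' _ _ _ _ (is_lim_seq_const 1)
    (is_lim_seq_minus' _ _ _ _ (is_lim_seq_const (Series f)) h).
  by rewrite Rminus_diag Rplus_0_r.
Qed.

Lemma euler_product_ln :
  is_lim_seq (prime_sum (fun q => - ln (1 - f q))) (ln (Series f)).
Proof.
have S0 : 0 < Series f.
  apply: Rlt_le_trans (sum_n_le_series f _ 1 f_ge0 (Series_correct _ f_sum)).
  by rewrite sum_Sn sum_O f_0 f_1 /plus /=; lra.
have hc : continuity_pt ln 1.
  apply: derivable_continuous_pt; exists (/ 1); apply: derivable_pt_lim_ln; lra.
have := is_lim_seq_continuous ln _ 1 hc euler_product.
rewrite ln_1 => h.
have := is_lim_seq_minus' _ _ _ _ (is_lim_seq_const (ln (Series f))) h.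
rewrite Rminus_0_r; apply: is_lim_seq_ext => N.
rewrite ln_mult ?ln_exp //; last exact: exp_pos.
rewrite (prime_sum_ext (fun q => - ln (1 - f q)) (fun q => -1 * ln (1 - f q))).
  by rewrite prime_sum_scal; lra.
by move=> *; lra.
Qed.

End Sieve.

(** * The zeta function near its pole *)

(** The power n^(-1-s), extended by 0 at n = 0 so that it is completely multiplicative on all of
    [nat]. *)
Definition zeta_term (s : R) (n : nat) : R :=
  match n with O => 0 | S _ => exp (- (1 + s) * ln (INR n)) end.

(* With this shift of the argument, [zeta s] is the classical zeta(1 + s). *)
Definition zeta (s : R) : R := Series (zeta_term s).

Lemma zeta_term_ge0 (s : R) (n : nat) : 0 <= zeta_term s n.
Proof. by case: n => [|n] /=; [lra|apply: Rlt_le; apply: exp_pos]. Qed.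

Lemma zeta_term_mul (s : R) (a b : nat) :
  zeta_term s (a * b)%N = zeta_term s a * zeta_term s b.
Proof.
case: a => [|a]; first by rewrite mul0n /=; lra.
case: b => [|b]; first by rewrite muln0 /=; lra.
have e : (a.+1 * b.+1 = (b + a * b.+1).+1)%N by lia.
rewrite {1}e /zeta_term -e mult_INR ln_mult; try (apply: lt_0_INR; lia).
by rewrite -exp_plus; congr exp; lra.
Qed.

Lemma zeta_term_1 (s : R) : zeta_term s 1 = 1.
Proof. by rewrite /zeta_term ln_1 Rmult_0_r exp_0. Qed.

Lemma zeta_termE (s : R) (n : nat) : (0 < n)%N ->
  zeta_term s n = exp (- s * ln (INR n)) * / INR n.
Proof.
case: n => // n _; have h : 0 < INR n.+1 by apply: lt_0_INR; lia.
rewrite /zeta_term -{3}(exp_ln _ h) -exp_Ropp -exp_plus; congr exp; lra.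
Qed.

Lemma exp_nondecreasing (x y : R) : x <= y -> exp x <= exp y.
Proof.
by case=> [/exp_increasing|->]; [apply: Rlt_le|apply: Rle_refl].
Qed.

Lemma zeta_term_prime (s : R) (q : nat) : 0 < s -> prime q -> zeta_term s q < 1.
Proof.
move=> hs hq; rewrite zeta_termE ?prime_gt0 //.
have hi := prime_inv_bounds q hq; have hl := ln_prime_ge0 q hq.
have : exp (- s * ln (INR q)) <= exp 0 by apply: exp_nondecreasing; nra.
by rewrite exp_0; have := exp_pos (- s * ln (INR q)); nra.
Qed.

(** The integral test for x^(-1-s), whose multiple by s is minus the derivative of x^(-s). Both
    sides follow from exp u >= 1 + u and 1/(x+1) <= ln (x+1) - ln x <= 1/x, after factoring out the
    power at x+1 or at x. *)
Lemma zeta_term_telescope (s : R) (n : nat) : 0 < s ->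
  s * zeta_term s n.+2 <= exp (- s * ln (INR n.+1)) - exp (- s * ln (INR n.+2))
  <= s * zeta_term s n.+1.
Proof.
move=> hs; rewrite !zeta_termE // (S_INR n.+1).
set x := INR n.+1; have hx : 0 < x by apply: lt_0_INR; lia.
set d := ln (x + 1) - ln x.
have hd : d = ln ((x + 1) / x) by rewrite ln_div //; lra.
have h0 : 0 < (x + 1) / x by apply: Rdiv_lt_0_compat; lra.
have d1 := ln_ge_1_sub_inv _ h0; have d2 := ln_le_sub_1 _ h0.
rewrite -hd in d1 d2.
have e1 : 1 - / ((x + 1) / x) = / (x + 1) by field; lra.
have e2 : (x + 1) / x - 1 = / x by field; lra.
rewrite e1 in d1; rewrite e2 in d2.
have -> : exp (- s * ln x) - exp (- s * ln (x + 1)) =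
   exp (- s * ln (x + 1)) * (exp (s * d) - 1).
  by rewrite Rmult_minus_distr_l -exp_plus /d; f_equal; [congr exp|]; lra.
split.
  rewrite -Rmult_assoc (Rmult_comm s) Rmult_assoc.
  apply: Rmult_le_compat_l; first by apply: Rlt_le; apply: exp_pos.
  have := exp_ineq1_le (s * d); nra.
have -> : exp (- s * ln (x + 1)) * (exp (s * d) - 1) = exp (- s * ln x) * (1 - exp (- (s * d))).
  by rewrite !Rmult_minus_distr_l -!exp_plus /d; f_equal; [|f_equal]; rewrite ?Rmult_1_r; congr exp; lra.
rewrite (_ : s * (_ * / x) = exp (- s * ln x) * (s * / x)); last by ring.
apply: Rmult_le_compat_l; first by apply: Rlt_le; apply: exp_pos.
have := exp_ineq1_le (- (s * d)); nra.
Qed.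

Lemma is_lim_seq_exp_neg (u : nat -> R) (c : R) : 0 < c ->
  is_lim_seq u p_infty -> is_lim_seq (fun n => exp (- c * u n)) 0.
Proof.
move=> hc hu.
apply: (is_lim_comp_seq exp (fun n => - c * u n) m_infty 0).
- exact: is_lim_exp_m.
- by exists 0%N.
- have -> : m_infty = Rbar_mult (- c) p_infty.
    symmetry; apply: is_Rbar_mult_unique; apply: is_Rbar_mult_sym.
    by apply: is_Rbar_mult_p_infty_neg; rewrite /=; lra.
  exact: is_lim_seq_scal_l.
Qed.

Lemma is_lim_seq_ln_S : is_lim_seq (fun n => ln (INR n.+1)) p_infty.
Proof.
apply: (is_lim_comp_seq ln (fun n => INR n.+1) p_infty p_infty).
- exact: is_lim_ln_p.
- by exists 0%N.
- exact: (proj1 (is_lim_seq_incr_1 _ _) is_lim_seq_INR).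
Qed.

Lemma is_series_zeta_telescope (s : R) : 0 < s ->
  is_series (fun n => exp (- s * ln (INR n.+1)) - exp (- s * ln (INR n.+2))) 1.
Proof.
move=> hs.
have := is_series_telescope (fun n => exp (- s * ln (INR n.+1))) 0
  (is_lim_seq_exp_neg _ _ hs is_lim_seq_ln_S).
move=> /is_series_opp.
have -> : opp (0 - exp (- s * ln (INR 1))) = 1.
  by rewrite /opp /= ln_1 Rmult_0_r exp_0; lra.
by apply: is_series_ext => n; rewrite /opp /=; lra.
Qed.

Lemma ex_series_zeta (s : R) : 0 < s -> ex_series (zeta_term s).
Proof.
move=> hs; apply/ex_series_incr_1; apply/ex_series_incr_1.
have h := ex_series_scal_l (/ s) _ (ex_intro _ _ (is_series_zeta_telescope s hs)).
apply: (@ex_series_le R_AbsRing R_CompleteNormedModule _ _ _ h) => n.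
have [h1 _] := zeta_term_telescope s n hs.
have h0 := zeta_term_ge0 s n.+2.
have -> : norm (zeta_term s n.+2) = zeta_term s n.+2 := Rabs_right _ (Rle_ge _ _ h0).
change (zeta_term s n.+2 <=
  / s * (exp (- s * ln (INR n.+1)) - exp (- s * ln (INR n.+2)))); apply: (Rmult_le_reg_l s) => //.
by rewrite -Rmult_assoc Rinv_r; lra.
Qed.

(** Summing the telescoping comparison; together the two bounds give ln zeta(1+s) = - ln s +
    o(1). *)
Lemma zeta_bounds (s : R) : 0 < s -> / s <= zeta s <= 1 + / s.
Proof.
move=> hs; have hz := ex_series_zeta s hs.
have h1 := proj1 (ex_series_incr_1 _) hz; have h2 := proj1 (ex_series_incr_1 _) h1.
have t := is_series_zeta_telescope s hs.
have e : zeta s = Series (fun n => zeta_term s n.+1).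
  by rewrite /zeta Series_incr_1 // /zeta_term Rplus_0_l.
have e2 : zeta s = 1 + Series (fun n => zeta_term s n.+2).
  by rewrite e Series_incr_1 // zeta_term_1.
have le1 : 1 <= s * zeta s.
  rewrite e -Series_scal_l -(is_series_unique _ _ t).
  apply: Series_le => [n|]; last exact: ex_series_scal_l.
  have [a b] := zeta_term_telescope s n hs; split => //.
  by apply: Rle_trans a; apply: Rmult_le_pos; [lra|apply: zeta_term_ge0].
have le2 : s * (zeta s - 1) <= 1.
  rewrite e2 (_ : 1 + _ - 1 = Series (fun n => zeta_term s n.+2)); last by lra.
  rewrite -Series_scal_l -(is_series_unique _ _ t).
  apply: Series_le => [n|]; last by exists 1.
  have [a b] := zeta_term_telescope s n hs; split => //.
  by apply: Rmult_le_pos; [lra|apply: zeta_term_ge0].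
have i : s * / s = 1 by rewrite Rinv_r; lra.
by split; apply: (Rmult_le_reg_l s) => //; lra.
Qed.

(** * The Abelian argument *)

(* The lower bound is the concavity of [ln]; the upper one combines [ln (1 + u) <= u]
   for [u = t (1 - r) / (1 - t)] with [- ln (1 - t) >= t]. It is used with [t = 1/q]
   and [r = q^(-s)]. *)
Lemma ln_one_minus_mul (t r : R) : 0 < t <= / 2 -> 0 <= r <= 1 ->
  0 <= r * - ln (1 - t) + ln (1 - r * t) <= (1 - r) * (t * t * / (1 - t)).
Proof.
move=> ht hr; have rt : 0 <= r * t <= / 2 by nra.
have y0 : 0 < 1 - r * t by lra.
have a0 : 0 < 1 - t by lra.
split.
- have q1 : 0 < (1 - t) / (1 - r * t) by apply: Rdiv_lt_0_compat.
  have q2 : 0 < / (1 - r * t) by apply: Rinv_0_lt_compat.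
  have h1 := ln_le_sub_1 _ q1; have h2 := ln_le_sub_1 _ q2.
  rewrite ln_div // in h1; rewrite ln_Rinv // in h2.
  have e : r * ((1 - t) / (1 - r * t) - 1) + (1 - r) * (/ (1 - r * t) - 1) = 0.
    by field; lra.
  nra.
- have q1 : 0 < (1 - r * t) / (1 - t) by apply: Rdiv_lt_0_compat.
  have h1 := ln_le_sub_1 _ q1; rewrite ln_div // in h1.
  have h2 := ln_le_sub_1 _ a0.
  have e : (1 - r) * (t * t * / (1 - t)) = (1 - r * t) / (1 - t) - 1 - (1 - r) * t.
    by field; lra.
  nra.
Qed.

Lemma prime_pow_bounds (s : R) (q : nat) : 0 < s -> prime q ->
  1 - s * ln (INR q) <= exp (- s * ln (INR q)) <= 1.
Proof.
move=> hs hq; have := exp_ineq1_le (- s * ln (INR q)) => h1.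
split; first by lra.
rewrite -exp_0; apply: exp_nondecreasing; have := ln_prime_ge0 q hq; nra.
Qed.

(** Exchanges the logarithm of the Euler factor of zeta at q for q^(-s) times the weight of q, which
    is what the blocks measure. Since 1 - q^(-s) <= s ln q, [ln_square_tail] bounds the total error
    by 2s uniformly in [N]. *)
Lemma prime_zeta_compare (s : R) (N : nat) : 0 < s ->
  prime_sum (fun q => - ln (1 - zeta_term s q)) N
  <= prime_sum (fun q => exp (- s * ln (INR q)) * euler_weight q) N
  <= prime_sum (fun q => - ln (1 - zeta_term s q)) N + 2 * s.
Proof.
move=> hs.
have key q : prime q ->
  0 <= exp (- s * ln (INR q)) * euler_weight q + ln (1 - zeta_term s q)
    <= s * (ln (INR q) * / (INR q * (INR q - 1))).
  move=> hq; have hi := prime_inv_bounds q hq.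
  have hr := prime_pow_bounds s q hs hq; have re := exp_pos (- s * ln (INR q)).
  rewrite zeta_termE ?prime_gt0 // /euler_weight.
  have h01 : 0 <= exp (- s * ln (INR q)) <= 1 by lra.
  have [h1 h2] := ln_one_minus_mul _ _ hi h01; split => //.
  apply: Rle_trans h2 _; have q2 := prime_ge2_R q hq.
  rewrite (_ : / INR q * / INR q * / (1 - / INR q) = / (INR q * (INR q - 1))); last by field; lra.
  rewrite -Rmult_assoc; apply: Rmult_le_compat_r; last by lra.
  by apply: Rlt_le; apply: Rinv_0_lt_compat; nra.
split; first by apply: prime_sum_le => q hq _; have := key q hq; lra.
have h := ln_square_tail N.
apply: (Rle_trans _ (prime_sum (fun q => - ln (1 - zeta_term s q)) N
   + s * prime_sum (fun q => ln (INR q) * / (INR q * (INR q - 1))) N)); last by nra.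
rewrite -prime_sum_scal -prime_sum_plus; apply: prime_sum_le => q hq _.
by have := key q hq; lra.
Qed.

Lemma exp_mul_INR (x : R) (n : nat) : exp (INR n * x) = exp x ^ n.
Proof.
elim: n => [|n IH]; first by rewrite Rmult_0_l exp_0.
by rewrite S_INR Rmult_plus_distr_r Rmult_1_l exp_plus IH /=; lra.
Qed.

(** For q in block m, q^(-s) lies between z^(m+1) and z^m. *)
Lemma prime_sum_blocks (s : R) (M : nat) : 0 < s ->
  let z := exp (- s * ln 2) in
  sum_n (fun m => block_weight m * z ^ m.+1) M
  <= prime_sum (fun q => exp (- s * ln (INR q)) * euler_weight q) (2 ^ M.+1)
  <= sum_n (fun m => block_weight m * z ^ m) M.
Proof.
move=> hs z; have h2 := ln2_pos.
have blk m : block_weight m * z ^ m.+1 <=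
   prime_sum (fun q => exp (- s * ln (INR q)) * euler_weight q) (2 ^ m.+1)
   - prime_sum (fun q => exp (- s * ln (INR q)) * euler_weight q) (2 ^ m)
   <= block_weight m * z ^ m.
  rewrite 2!(Rmult_comm (block_weight m)) /block_weight 2!Rmult_minus_distr_l -!prime_sum_scal.
  rewrite -2!exp_mul_INR.
  split; apply: prime_sum_diff_le; try exact: pow2_le;
    move=> q hq q1 q2; have [b1 b2] := ln_block _ _ q1 q2;
    (apply: Rmult_le_compat_r; first exact: euler_weight_ge0);
    apply: exp_nondecreasing; rewrite ?S_INR; nra.
elim: M => [|M IH].
  have := blk 0%N; rewrite !sum_O (_ : prime_sum _ (2 ^ 0) = 0) //; last by rewrite /= Rplus_0_l.
  by lra.
by have := blk M.+1; rewrite !sum_Sn /plus /=; move: IH; rewrite /=; lra.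
Qed.

Lemma CV_radius_one : CV_radius (fun=> 1) = 1.
Proof.
rewrite (CV_radius_finite_DAlembert _ 1) ?Rinv_1 //; try lra.
apply: (is_lim_seq_ext (fun=> 1)); last exact: is_lim_seq_const.
by move=> n; rewrite Rabs_right; lra.
Qed.

(** Termwise integration of the geometric series from 0 to z. *)
Lemma is_series_ln (z : R) : 0 < z < 1 ->
  is_series (fun m => / (INR m + 1) * z ^ m.+1) (- ln (1 - z)).
Proof.
move=> hz.
have hr : Rbar_lt (Rabs z) (CV_radius (fun=> 1)).
  by rewrite CV_radius_one /= Rabs_right; lra.
have := is_pseries_RInt _ _ hr.
have -> : RInt (PSeries (fun=> 1)) 0 z = - ln (1 - z).
  apply: is_RInt_unique.
  apply: (is_RInt_ext (fun x => / (1 - x))).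
    move=> x; rewrite Rmin_left ?Rmax_right; try lra; move=> hx.
    symmetry; apply: is_series_unique.
    have hq : Rabs x < 1 by rewrite Rabs_right; lra.
    by apply: is_series_ext (is_series_geom x hq) => n; rewrite Rmult_1_l.
  have -> : - ln (1 - z) = minus (- ln (1 - z)) (- ln (1 - 0)).
    by rewrite /minus /plus /opp /= Rminus_0_r ln_1; lra.
  apply: (is_RInt_derive (fun x => - ln (1 - x)) (fun x => / (1 - x))).
  - move=> x; rewrite Rmin_left ?Rmax_right; try lra; move=> hx.
    by auto_derive; [lra|field; lra].
  - move=> x; rewrite Rmin_left ?Rmax_right; try lra; move=> hx.
    apply: (@ex_derive_continuous R_AbsRing); auto_derive; lra.
set a := fun k => scal (pow_n z k) (PS_Int (fun=> 1) k).
(* The integrated series starts with a zero term; writing the sum with that term split off allows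
   the index to be shifted. *)
move=> h; have {}h : is_series a (plus (- ln (1 - z)) (a 0%N)).
  have -> : a 0%N = 0 by rewrite /a /scal /= /mult /= Rmult_0_r.
  by rewrite /plus /= Rplus_0_r.
have := is_series_incr_1 _ _ h.
apply: is_series_ext => n; rewrite /a pow_n_pow /PS_Int S_INR.
by rewrite /scal /= /mult /=; field; have := pos_INR n; lra.
Qed.

Lemma CV_radius_ge_1 (a : nat -> R) : ex_series a -> Rbar_le 1 (CV_radius a).
Proof.
move=> /ex_series_lim_0 ha; apply: Rbar_not_lt_le => h.
apply: (CV_disk_outside a 1); first by rewrite Rabs_R1.
by apply: is_lim_seq_ext ha => n; rewrite pow1; lra.
Qed.

(** If the radius of convergence exceeds 1 this is continuity inside the disk; if it equals 1, it is
    Abel's theorem along a sequence to the left of 1. *)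
Lemma abel_limit (a z : nat -> R) : ex_series a ->
  (forall n, 0 < z n < 1) -> is_lim_seq z 1 ->
  is_lim_seq (fun n => PSeries a (z n)) (Series a).
Proof.
move=> ha hz lz.
have ea : Series a = PSeries a 1 by apply: Series_ext => n; rewrite pow1; lra.
have := CV_radius_ge_1 a ha; rewrite ea.
case/Rbar_le_lt_or_eq_dec => [hlt|heq].
- have hc : continuity_pt (PSeries a) 1 by apply: PSeries_continuity; rewrite Rabs_R1.
  exact: is_lim_seq_continuous.
- have := Abel a; rewrite -heq => hA.
  have {}hA : filterlim (PSeries a) (at_left 1) (locally (PSeries a 1)).
    apply: hA => //; first by rewrite /=; lra.
    apply: ex_series_ext ha => n; rewrite pow_n_pow pow1 /scal /= /mult /=; lra.
  apply: (filterlim_comp _ _ _ z (PSeries a) _ _ _ _ hA).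
  move=> P [eps hP]; have := lz _ (locally_ball 1 eps) => - [N hN].
  by exists N => n hn; apply: hP; [apply: hN|case: (hz n)].
Qed.

Definition block_error (m : nat) : R := block_weight m - / (INR m + 1).

Lemma is_series_block (z : R) : 0 < z < 1 ->
  is_series (fun m => block_weight m * z ^ m.+1) (z * PSeries block_error z - ln (1 - z)).
Proof.
move=> hz.
have hs : is_series (fun m => scal z (block_error m * z ^ m)) (scal z (PSeries block_error z)).
  apply: is_series_scal_l; apply: Series_correct.
  have hr : Rbar_lt (Rabs z) (CV_radius block_error).
    have h1 := CV_radius_ge_1 _ ex_series_block_weight.
    by apply: Rbar_lt_le_trans h1; rewrite /= Rabs_right; lra.
  by apply: ex_series_Rabs; apply: CV_disk_inside.
have := is_series_plus _ _ _ _ hs (is_series_ln z hz).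
apply: is_series_ext => n.
by rewrite /plus /scal /= /mult /= /block_error; ring.
Qed.

Lemma zeta_term_sum_ln (s : R) : 0 < s ->
  is_lim_seq (prime_sum (fun q => - ln (1 - zeta_term s q))) (ln (zeta s)).
Proof.
move=> hs; apply: euler_product_ln => //.
- exact: zeta_term_mul.
- exact: zeta_term_ge0.
- exact: zeta_term_1.
- by move=> q; apply: zeta_term_prime.
- exact: ex_series_zeta.
Qed.

(** Both comparisons pass to the limit along the bounds 2^(M+1). The upper bound in
    [prime_sum_blocks] has z^m where [G] has z^(m+1), hence the factor z before ln zeta. *)
Lemma block_series_vs_zeta (s : R) : 0 < s ->
  let z := exp (- s * ln 2) in
  let G := z * PSeries block_error z - ln (1 - z) in
  G <= ln (zeta s) + 2 * s /\ z * ln (zeta s) <= G.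
Proof.
move=> hs z G; have h2 := ln2_pos.
have z0 : 0 < z := exp_pos _.
have z1 : z < 1 by rewrite -exp_0; apply: exp_increasing; nra.
have hG : is_series (fun m => block_weight m * z ^ m.+1) G by apply: is_series_block.
have hG' : is_lim_seq (sum_n (fun m => block_weight m * z ^ m.+1)) G := hG.
have hZ : is_lim_seq (fun M => prime_sum (fun q => - ln (1 - zeta_term s q)) (2 ^ M.+1)) (ln (zeta s)).
  apply: (is_lim_seq_subseq _ _ (fun M => 2 ^ M.+1)%N); last exact: zeta_term_sum_ln.
  apply: eventually_subseq => n; rewrite (expnS _ n.+1); have := expn_gt0 2 n.+1; lia.
split.
- apply: (is_lim_seq_le _ _ _ _ _ hG'
    (is_lim_seq_plus' _ _ _ _ hZ (is_lim_seq_const (2 * s)))) => M.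
  have [b1 _] := prime_sum_blocks s M hs.
  have [_ c2] := prime_zeta_compare s (2 ^ M.+1) hs.
  exact: Rle_trans b1 c2.
- apply: (is_lim_seq_le _ _ _ _ _ (is_lim_seq_scal_l _ z _ hZ) hG') => M.
  have [_ b2] := prime_sum_blocks s M hs.
  have [c1 _] := prime_zeta_compare s (2 ^ M.+1) hs.
  have h := Rle_trans _ _ _ c1 b2.
  apply: Rle_trans (Rmult_le_compat_l _ _ _ (Rlt_le _ _ z0) h) _.
  apply: Req_le; rewrite -[z * _](sum_n_mult_l z); apply: sum_n_ext => m.
  by rewrite /mult /= -/z; ring.
Qed.

(** The terms - ln s of ln zeta and ln s of ln (1 - z) cancel, leaving ln (ln 2), because (1 - z)/s
    tends to ln 2. All errors are explicit and vanish with s. *)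
Lemma block_abel_bound (s : R) : 0 < s ->
  let z := exp (- s * ln 2) in
  ln (ln 2) - s * ln 2 - s * ln 2 * ln (1 + / s)
    <= z * PSeries block_error z <= ln (ln 2) + 3 * s.
Proof.
move=> hs z; have h2 := ln2_pos.
have z0 : 0 < z := exp_pos _.
have z1 : z < 1 by rewrite -exp_0; apply: exp_increasing; nra.
have is0 : 0 < / s by apply: Rinv_0_lt_compat.
have [g1 g2] := block_series_vs_zeta s hs; rewrite -/z in g1 g2.
have [zl zu] := zeta_bounds s hs.
have lz1 : - ln s <= ln (zeta s) by rewrite -ln_Rinv //; apply: ln_le.
have lz2 : ln (zeta s) <= ln (1 + / s) by apply: ln_le; lra.
have lz3 : ln (1 + / s) <= - ln s + s.
  have -> : 1 + / s = / s * (1 + s) by field; lra.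
  rewrite ln_mult ?ln_Rinv //; last by lra.
  have h : 0 < 1 + s by lra.
  by have := ln_le_sub_1 _ h; lra.
have u1 : 1 - z <= s * ln 2.
  by have := exp_ineq1_le (- s * ln 2); rewrite -/z; lra.
have u2 : z * (s * ln 2) <= 1 - z.
  have e : z * exp (s * ln 2) = 1.
    by rewrite /z -exp_plus -exp_0; congr exp; lra.
  have := exp_ineq1_le (s * ln 2); nra.
have v1 : ln (1 - z) <= ln s + ln (ln 2).
  by rewrite -ln_mult //; apply: ln_le; lra.
have v2 : - s * ln 2 + (ln s + ln (ln 2)) <= ln (1 - z).
  rewrite -ln_mult // -[- s * ln 2]ln_exp -/z -ln_mult //; last by nra.
  by apply: ln_le => //; apply: Rmult_lt_0_compat => //; nra.
have w : 0 <= ln (1 + / s) by rewrite -ln_1; apply: ln_le; lra.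
(* The price of the factor z in front of ln zeta in the lower bound. *)
have w2 : (1 - z) * ln (zeta s) <= s * ln 2 * ln (1 + / s).
  apply: (Rle_trans _ ((1 - z) * ln (1 + / s))); last exact: Rmult_le_compat_r.
  by apply: Rmult_le_compat_l; lra.
split; lra.
Qed.

(** Along s = 1/(n+1), Abel's theorem and the squeeze of [block_abel_bound] give two values for the
    same limit. *)
Lemma series_block_error : Series block_error = ln (ln 2).
Proof.
have h2 := ln2_pos.
pose s n := / (INR n + INR 1).
have s0 n : 0 < s n by apply: Rinv_0_lt_compat; have := pos_INR n; rewrite /=; lra.
have sl : is_lim_seq s 0 := is_lim_seq_inv_n 1.
pose z n := exp (- s n * ln 2).
have zl : is_lim_seq z 1.
  rewrite -exp_0.
  apply: (is_lim_seq_continuous exp (fun n => - s n * ln 2)).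
    exact: (derivable_continuous exp derivable_exp).
  have := is_lim_seq_mult' _ _ _ _ sl (is_lim_seq_const (- ln 2)).
  by rewrite Rmult_0_l; apply: is_lim_seq_ext => n; lra.
have hz n : 0 < z n < 1.
  split; first exact: exp_pos.
  by rewrite -exp_0; apply: exp_increasing; have := s0 n; nra.
have lim1 := is_lim_seq_mult' _ _ _ _ zl
  (abel_limit _ _ ex_series_block_weight hz zl).
rewrite Rmult_1_l in lim1.
(* With s = 1/(n+1), the term is ln (n+2) / (n+2) times 1 + s. *)
have ll : is_lim_seq (fun n => s n * ln (1 + / s n)) 0.
  have hq : is_lim_seq (fun n => ln (INR n.+2) / INR n.+2) 0.
    apply: (is_lim_comp_seq (fun y => ln y / y) (fun n => INR n.+2) p_infty 0).
    - exact is_lim_div_ln_p.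
    - by exists 0%N.
    - exact (proj1 (is_lim_seq_incr_1 (fun n => INR n.+1) p_infty)
        (proj1 (is_lim_seq_incr_1 INR p_infty) is_lim_seq_INR)).
  have := is_lim_seq_mult' _ _ _ _ hq (is_lim_seq_plus' _ _ _ _ (is_lim_seq_const 1) sl).
  rewrite Rmult_0_l; apply: is_lim_seq_ext => n.
  rewrite /s Rinv_inv (_ : 1 + (INR n + INR 1) = INR n.+2); last by rewrite !S_INR /=; lra.
  rewrite !S_INR /=; have hn := pos_INR n; field; lra.
have lim2 : is_lim_seq (fun n => z n * PSeries block_error (z n)) (ln (ln 2)).
  apply: (is_lim_seq_le_le (fun n => ln (ln 2) - s n * ln 2 - s n * ln 2 * ln (1 + / s n)) _
     (fun n => ln (ln 2) + 3 * s n)).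
  - by move=> n; apply: block_abel_bound.
  - have := is_lim_seq_minus' _ _ _ _ (is_lim_seq_minus' _ _ _ _ (is_lim_seq_const (ln (ln 2)))
      (is_lim_seq_mult' _ _ _ _ sl (is_lim_seq_const (ln 2))))
      (is_lim_seq_mult' _ _ _ _ (is_lim_seq_const (ln 2)) ll).
    rewrite Rmult_0_l Rmult_0_r !Rminus_0_r; apply: is_lim_seq_ext => n; ring.
  - have := is_lim_seq_plus' _ _ _ _ (is_lim_seq_const (ln (ln 2)))
      (is_lim_seq_mult' _ _ _ _ (is_lim_seq_const 3) sl).
    by rewrite Rmult_0_r Rplus_0_r.
have := is_lim_seq_unique _ _ lim1; rewrite (is_lim_seq_unique _ _ lim2).
by case.
Qed.

(** * Mertens' third theorem *)

Lemma ln_succ_bounds (n : nat) :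
  / INR n.+2 <= ln (INR n.+2) - ln (INR n.+1) <= / INR n.+1.
Proof.
have h1 : 0 < INR n.+1 by apply: lt_0_INR; lia.
have e : INR n.+2 = INR n.+1 + 1 by rewrite (S_INR n.+1).
have q : 0 < INR n.+2 / INR n.+1 by apply: Rdiv_lt_0_compat; lra.
have a1 := ln_ge_1_sub_inv _ q; have a2 := ln_le_sub_1 _ q.
rewrite ln_div in a1 a2; try lra.
rewrite e in a1 a2 *; split.
- by apply: Rle_trans a1; apply: Req_le; field; lra.
- by apply: Rle_trans a2 _; apply: Req_le; field; lra.
Qed.

(** [euler_gamma] is the real part of a [Lim_seq], meaningful only once the limit is known to be
    finite: the sequence decreases and is bounded below by 0. *)
Lemma euler_gamma_lim :
  is_lim_seq (fun n => sum_f_R0 (fun k => / INR (S k)) n - ln (INR (S n))) euler_gamma.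
Proof.
apply: Lim_seq_correct'.
apply: (ex_finite_lim_seq_decr _ 0) => n.
- by rewrite tech5; have := ln_succ_bounds n; lra.
- suff : ln (INR n.+2) <= sum_f_R0 (fun k => / INR k.+1) n.
    by have := ln_succ_bounds n; have := Rinv_0_lt_compat (INR n.+2) (lt_0_INR _ (Nat.lt_0_succ _)); lra.
  elim: n => [|n IH].
    by have := ln_succ_bounds 0; rewrite [INR 1]/= ln_1 [sum_f_R0 _ _]/=; lra.
  by rewrite tech5; have := ln_succ_bounds n.+1; lra.
Qed.

Lemma euler_weight_sum_pow2 (m : nat) :
  prime_sum euler_weight (2 ^ m.+1) =
  sum_n block_error m + sum_f_R0 (fun k => / INR k.+1) m.
Proof.
have := sum_n_telescope (fun k => prime_sum euler_weight (2 ^ k)) m.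
have -> : prime_sum euler_weight (2 ^ 0) = 0 by rewrite /= Rplus_0_l.
rewrite Rminus_0_r => <-; rewrite -sum_n_Reals.
change (sum_n block_error m + sum_n (fun k => / INR k.+1) m)
  with (plus (sum_n block_error m) (sum_n (fun k => / INR k.+1) m)).
rewrite -sum_n_plus; apply: sum_n_ext => n.
by rewrite /plus /= /block_error /block_weight -/(INR n.+1) S_INR; ring.
Qed.

(** The limit ln (ln 2) of the error sums cancels the one hidden in ln ((m+1) ln 2); what remains is
    the harmonic sum minus ln (m+1), whence gamma. *)
Lemma mertens3_pow2 :
  is_lim_seq (fun m => prime_sum euler_weight (2 ^ m.+1) - ln ((INR m + 1) * ln 2)) euler_gamma.
Proof.
have h2 := ln2_pos.
have h : is_lim_seq (sum_n block_error) (ln (ln 2)).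
  rewrite -series_block_error; exact: Series_correct ex_series_block_weight.
have := is_lim_seq_plus' _ _ _ _ (is_lim_seq_minus' _ _ _ _ h (is_lim_seq_const (ln (ln 2)))) euler_gamma_lim.
rewrite Rminus_diag Rplus_0_l; apply: is_lim_seq_ext => m.
rewrite euler_weight_sum_pow2 -S_INR ln_mult //; first by ring.
by apply: lt_0_INR; lia.
Qed.

Lemma is_lim_seq_ln_ratio : is_lim_seq (fun m => ln ((INR m + 2) / (INR m + 1))) 0.
Proof.
apply: (is_lim_seq_le_le (fun=> 0) _ (fun m => / (INR m + INR 1))).
- move=> m; have := ln_succ_bounds m; have hm := pos_INR m.
  have : 0 <= / INR m.+2 by apply: Rlt_le; apply: Rinv_0_lt_compat; apply: lt_0_INR; lia.
  rewrite -ln_div; try (apply: lt_0_INR; lia).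
  have -> : INR m.+2 = INR m + 2 by rewrite !S_INR; lra.
  by rewrite S_INR [INR 1]/=; lra.
- exact: is_lim_seq_const.
- exact: is_lim_seq_inv_n.
Qed.

(** Interpolates between powers of 2: the prime sum is monotone, and ln ln varies by at most ln
    ((m+2)/(m+1)), which tends to 0, between 2^(m+1) and 2^(m+2). *)
Lemma mertens3 :
  is_lim_seq (fun N => prime_sum euler_weight N - ln (ln (INR N))) euler_gamma.
Proof.
have h2 := ln2_pos.
pose m N := (trunc_log 2 N).-1.
have mP N : (1 < N)%N -> (2 ^ (m N).+1 <= N)%N /\ (N <= 2 ^ (m N).+2)%N.
  move=> N1; have /andP [t1 t2] := trunc_log_bounds (ltnSn 1) (ltnW N1).
  have t0 : (0 < trunc_log 2 N)%N by rewrite trunc_log_gt0.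
  by rewrite /m prednK //; split => //; apply: ltnW.
have mlim : filterlim m eventually eventually.
  move=> P [M hM]; exists (2 ^ M.+1)%N => N hN; apply: hM.
  have : (M.+1 <= trunc_log 2 N)%N by apply: trunc_log_max => //; lia.
  rewrite /m; lia.
have b1 : is_lim_seq (fun N => prime_sum euler_weight (2 ^ (m N).+1)
    - ln ((INR (m N) + 1) * ln 2) - ln ((INR (m N) + 2) / (INR (m N) + 1))) euler_gamma.
  have := is_lim_seq_minus' _ _ _ _ mertens3_pow2 is_lim_seq_ln_ratio.
  by rewrite Rminus_0_r => /(is_lim_seq_subseq _ _ m mlim).
have b2 : is_lim_seq (fun N => prime_sum euler_weight (2 ^ (m N).+2)
    - ln ((INR (m N).+1 + 1) * ln 2) + ln ((INR (m N) + 2) / (INR (m N) + 1))) euler_gamma.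
  have := is_lim_seq_plus' _ _ _ _ (proj1 (is_lim_seq_incr_1 _ _) mertens3_pow2) is_lim_seq_ln_ratio.
  by rewrite Rplus_0_r => /(is_lim_seq_subseq _ _ m mlim).
apply: (is_lim_seq_le_le_loc _ _ _ _ _ b1 b2).
exists 2%N => N hN; have [n1 n2] := mP N ltac:(lia).
have hm := pos_INR (m N).
have w1 : prime_sum euler_weight (2 ^ (m N).+1) <= prime_sum euler_weight N.
  by apply: prime_sum_incr => // q hq _ _; apply: euler_weight_ge0.
have w2 : prime_sum euler_weight N <= prime_sum euler_weight (2 ^ (m N).+2).
  by apply: prime_sum_incr => // q hq _ _; apply: euler_weight_ge0.
have p1 : 0 < 2 ^ (m N).+1 by apply: pow_lt; lra.
have N1 : 2 ^ (m N).+1 <= INR N by rewrite -INR_pow2; apply: le_INR; lia.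
have N2 : INR N <= 2 ^ (m N).+2 by rewrite -INR_pow2; apply: le_INR; lia.
have l1 : (INR (m N) + 1) * ln 2 <= ln (INR N).
  by rewrite -S_INR -ln_pow; [apply: ln_le|lra].
have l2 : ln (INR N) <= (INR (m N) + 2) * ln 2.
  have -> : INR (m N) + 2 = INR (m N).+2 by rewrite !S_INR; lra.
  by rewrite -ln_pow; [apply: ln_le; lra|lra].
have k1 : 0 < (INR (m N) + 1) * ln 2 by nra.
have ll1 : ln ((INR (m N) + 1) * ln 2) <= ln (ln (INR N)) by apply: ln_le.
have ll2 : ln (ln (INR N)) <= ln ((INR (m N) + 2) * ln 2) by apply: ln_le; lra.
have e : ln ((INR (m N) + 2) / (INR (m N) + 1)) =
  ln ((INR (m N) + 2) * ln 2) - ln ((INR (m N) + 1) * ln 2).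
  by rewrite ln_div ?ln_mult; lra.
rewrite S_INR (_ : INR (m N) + 1 + 1 = INR (m N) + 2); last by lra.
rewrite e; lra.
Qed.

Lemma mertens3_exp :
  is_lim_seq (fun N => exp (- prime_sum euler_weight N) * ln (INR N)) (exp (- euler_gamma)).
Proof.
have hc : continuity_pt exp (- euler_gamma) := derivable_continuous exp derivable_exp _.
have := is_lim_seq_continuous _ _ _ hc (proj1 (is_lim_seq_opp _ _) mertens3).
apply: is_lim_seq_ext_loc; exists 2%N => N hN.
rewrite /Rminus Ropp_plus_distr Ropp_involutive exp_plus exp_ln //.
have : 2 <= INR N by rewrite -[2]/(INR 2); apply: le_INR; lia.
move=> h; apply: Rlt_le_trans ln2_pos _; apply: ln_le; lra.
Qed.

(** * The integral of the density *)

Section Enumeration.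

Variable p : nat -> nat.
Hypothesis hp : prime_enum p.

Lemma enum_incr (i j : nat) : (1 <= i)%N -> (i < j)%N -> (p i < p j)%N.
Proof. by move=> hi hij; have := proj1 hp i j; lia. Qed.

Lemma enum_mono (i j : nat) : (1 <= i)%N -> (i <= j)%N -> (p i <= p j)%N.
Proof.
move=> hi; rewrite leq_eqVlt => /orP [/eqP -> //|hij].
exact: ltnW (enum_incr i j hi hij).
Qed.

Lemma enum_prime (j : nat) : (1 <= j)%N -> prime (p j).
Proof.
move=> hj; apply/Zprime_prime; apply: (proj2 (proj2 hp (p j))).
by exists j; split => //; lia.
Qed.

Lemma enum_surj (q : nat) : prime q -> exists2 j, (1 <= j)%N & p j = q.
Proof.
move=> hq; have [j [hj e]] := proj1 (proj2 hp q) (proj2 (Zprime_prime q) hq).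
by exists j => //; lia.
Qed.

Lemma enum_ge (j : nat) : (1 <= j)%N -> (j < p j)%N.
Proof.
elim: j => // [[|j]] IH _; first exact: prime_gt1 (enum_prime 1 isT).
have := enum_incr j.+1 j.+2 isT (ltnSn _); have := IH isT; lia.
Qed.

Lemma enum_1 : p 1%N = 2%N.
Proof.
have [j hj e] := enum_surj 2 isT.
have := enum_mono 1 j isT hj; have := enum_ge 1 isT; lia.
Qed.

Lemma enum_gap (j q : nat) : prime q -> (p j.+1 < q)%N -> (p j.+2 <= q)%N.
Proof.
move=> hq; have [i hi <-] := enum_surj q hq => h.
apply: enum_mono => //; rewrite ltnNge; apply/negP => hij.
by have := enum_mono i j.+1 hi hij; lia.
Qed.

Lemma prime_sum_gap (f : nat -> R) (M N : nat) : (M <= N)%N ->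
  (forall q, (M < q)%N -> (q <= N)%N -> ~~ prime q) -> prime_sum f N = prime_sum f M.
Proof.
elim: N => [|N IH] hMN hN; first by congr prime_sum; lia.
case: (ltngtP M N.+1) hMN => // [hlt|->] // _.
rewrite prime_sumS ifF; last by apply/negbTE; apply: hN.
rewrite Rplus_0_r; apply: IH; first by lia.
by move=> q h1 h2; apply: hN => //; apply: leqW.
Qed.

(** Passes from rank to size of the primes: the sum is constant between consecutive values of
    [p]. *)
Lemma mertens_prodE (j : nat) :
  mertens_prod p j.+1 = exp (- prime_sum euler_weight (p j.+1)).
Proof.
have step r : prime r ->
  exp (- prime_sum euler_weight r) = exp (- prime_sum euler_weight r.-1) * (1 - / INR r).
  move=> hr; rewrite -{1}(prednK (prime_gt0 hr)) prime_sumS prednK ?prime_gt0 // hr.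
  have hi := prime_inv_bounds r hr.
  by rewrite Ropp_plus_distr exp_plus /euler_weight Ropp_involutive exp_ln //; lra.
elim: j => [|j IH].
  rewrite (step _ (enum_prime 1 isT)) /= enum_1 /= Rplus_0_l.
  by rewrite Ropp_0 exp_0.
rewrite (step _ (enum_prime j.+2 isT)) [mertens_prod _ _]/= -/(mertens_prod p j.+1) IH.
congr (exp (- _) * _); symmetry; apply: prime_sum_gap.
  by have := enum_incr j.+1 j.+2 isT (ltnSn _); lia.
move=> q h1 h2; apply/negP => hq; have := enum_gap j q hq h1.
by have := enum_ge j.+2 isT; lia.
Qed.

Lemma is_lim_enum (u : nat -> R) (l : Rbar) :
  is_lim_seq u l -> is_lim_seq (fun k => u (p k.+1)) l.
Proof.
apply: (is_lim_seq_subseq u l (fun k => p k.+1)).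
apply: eventually_subseq => n; have := enum_incr n.+1 n.+2 isT (ltnSn _); lia.
Qed.

Lemma mertens_prod_lower_lim :
  is_lim_seq (fun k => mertens_prod p k * ln (INR (p k))) (exp (- euler_gamma)).
Proof.
apply/is_lim_seq_incr_1; have := is_lim_enum _ _ mertens3_exp.
by apply: is_lim_seq_ext => k; rewrite mertens_prodE.
Qed.

(** The preceding limit at k+1, with the last factor 1 - 1/p_(k+1), which tends to 1, divided
    out. *)
Lemma mertens_prod_upper_lim :
  is_lim_seq (fun k => mertens_prod p k * ln (INR (p k.+1))) (exp (- euler_gamma)).
Proof.
have h1 := proj1 (is_lim_seq_incr_1 _ _) mertens_prod_lower_lim.
have h2 : is_lim_seq (fun k => 1 - / INR (p k.+1)) 1.
  have h3 : is_lim_seq (fun n => / INR n) 0.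
    by apply: (is_lim_seq_inv _ p_infty) => //; exact: is_lim_seq_INR.
  have := is_lim_seq_minus' _ _ _ _ (is_lim_seq_const 1) (is_lim_enum _ _ h3).
  by rewrite Rminus_0_r.
have := is_lim_seq_div' _ _ _ _ h1 h2 ltac:(lra).
rewrite Rdiv_1_r; apply: is_lim_seq_ext => k.
have hi := prime_inv_bounds _ (enum_prime k.+1 isT).
have q2 := prime_ge2_R _ (enum_prime k.+1 isT).
rewrite [mertens_prod p k.+1]/=; field; lra.
Qed.

Lemma enum_sq_lt (i j : nat) : (1 <= i)%N -> (i < j)%N -> INR (p i) ^ 2 < INR (p j) ^ 2.
Proof.
move=> hi hij; have h0 := pos_INR (p i).
have : INR (p i) < INR (p j) by apply: lt_INR; have := enum_incr i j hi hij; lia.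
by rewrite /=; nra.
Qed.

Lemma enum_sq_le (i j : nat) : (1 <= i)%N -> (i <= j)%N -> INR (p i) ^ 2 <= INR (p j) ^ 2.
Proof.
move=> hi; rewrite leq_eqVlt => /orP [/eqP ->|hij]; first by lra.
exact: Rlt_le (enum_sq_lt i j hi hij).
Qed.

Lemma k_ofP (x : R) : 4 <= x ->
  (1 <= k_of p x)%N /\ INR (p (k_of p x)) ^ 2 <= x < INR (p (k_of p x).+1) ^ 2.
Proof.
move=> hx.
suff : exists k, (1 <= k)%coq_nat /\ INR (p k) ^ 2 <= x < INR (p k.+1) ^ 2.
  by move=> /(epsilon_spec (inhabits 0%N)) [h1 h2]; split => //; apply/leP.
have [n hn] := nfloor_ex x ltac:(lra).
have : x < INR (p n.+1) ^ 2.
  have := enum_ge n.+1 isT => h.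
  have : INR n.+1 <= INR (p n.+1) by apply: le_INR; lia.
  by rewrite S_INR /=; have := pos_INR n; nra.
(* Descent from a square above x to the last square not exceeding x; it stops in time because p_1^2
   = 4 <= x. *)
elim: n {hn} => [|n IH] hn.
  by move: hn; rewrite enum_1 /=; lra.
case: (Rlt_le_dec x (INR (p n.+1) ^ 2)) => [|h]; first exact: IH.
by exists n.+1; split => //; lia.
Qed.

Lemma k_of_unique (x : R) (k : nat) : 4 <= x -> (1 <= k)%N ->
  INR (p k) ^ 2 <= x < INR (p k.+1) ^ 2 -> k_of p x = k.
Proof.
move=> hx hk hkx; have [h1 h2] := k_ofP x hx.
case: (ltngtP (k_of p x) k) => // h.
- have := enum_sq_le (k_of p x).+1 k isT h; lra.
- have := enum_sq_le k.+1 (k_of p x) isT h; lra.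
Qed.

Lemma enum_sq_ge4 (k : nat) : (1 <= k)%N -> 4 <= INR (p k) ^ 2.
Proof. by move=> /enum_prime /prime_ge2_R h; rewrite /=; nra. Qed.

Definition pi_density (t : R) : R := mertens_prod p (k_of p t).

Lemma is_RInt_pi_density_piece (k : nat) (x : R) : (1 <= k)%N ->
  INR (p k) ^ 2 <= x <= INR (p k.+1) ^ 2 ->
  is_RInt pi_density (INR (p k) ^ 2) x ((x - INR (p k) ^ 2) * mertens_prod p k).
Proof.
move=> hk hx; apply: (is_RInt_ext (fun=> mertens_prod p k)); last exact: is_RInt_const.
(* Only interior points matter, so the endpoint p_(k+1)^2, where the density already jumps, is
   allowed for [x]. *)
rewrite Rmin_left ?Rmax_right; try lra; move=> t ht.
rewrite /pi_density (k_of_unique t k) //; last by lra.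
by have := enum_sq_ge4 k hk; lra.
Qed.

Lemma is_RInt_pit_sum (j : nat) :
  is_RInt pi_density (INR (p 1) ^ 2) (INR (p j.+1) ^ 2) (pit_sum p j).
Proof.
elim: j => [|j IH]; first exact: is_RInt_point.
apply: (is_RInt_Chasles _ _ _ _ _ _ IH).
apply: is_RInt_pi_density_piece => //; split; last by lra.
exact: enum_sq_le.
Qed.

Lemma is_RInt_pitilde (x : R) : 4 <= x -> is_RInt pi_density 4 x (pitilde p x).
Proof.
move=> hx; have [h1 h2] := k_ofP x hx.
rewrite /pitilde; set k := k_of p x in h1 h2 *.
have -> : (k - 1)%coq_nat = k.-1 by lia.
have := is_RInt_pit_sum k.-1; rewrite prednK // enum_1.
have -> : INR 2 ^ 2 = 4 by rewrite /=; lra.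
move=> i1; have i2 := is_RInt_pi_density_piece k x h1 ltac:(lra).
have := is_RInt_Chasles _ _ _ _ _ _ i1 i2.
congr is_RInt; rewrite /plus /= /pit_j.
have := enum_sq_lt k k.+1 h1 (ltnSn k); rewrite -/(ell p k) => hl.
have l0 : ell p k <> 0 by rewrite /ell; lra.
by congr (_ + _); rewrite /=; field.
Qed.

(** Mertens' theorem at sqrt t: since 2 ln p_k <= ln t <= 2 ln p_(k+1), the product times ln t is
    squeezed between two sequences with limit 2 e^(-gamma). The error is relative so that it can be
    integrated. *)
Lemma pi_density_lim (eps : R) : 0 < eps ->
  exists2 x0, 4 <= x0 &
  forall t, x0 <= t -> Rabs (pi_density t - 2 * exp (- euler_gamma) * / ln t)
    <= eps * (2 * exp (- euler_gamma) * / ln t).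
Proof.
move=> he; set c := exp (- euler_gamma); have c0 : 0 < c := exp_pos _.
have ec : 0 < eps * c by nra.
have /is_lim_seq_spec /(_ (mkposreal _ ec)) [K1 h1] := mertens_prod_lower_lim.
have /is_lim_seq_spec /(_ (mkposreal _ ec)) [K2 h2] := mertens_prod_upper_lim.
(* The successor guarantees a rank of at least 1. *)
pose K := (maxn K1 K2).+1.
exists (INR (p K) ^ 2); first exact: enum_sq_ge4.
move=> t ht; have t4 : 4 <= t by have := enum_sq_ge4 K isT; lra.
have [k1 k2] := k_ofP t t4; rewrite /pi_density; set k := k_of p t in k1 k2 *.
have hkK : (K <= k)%N.
  rewrite leqNgt; apply/negP => h; have := enum_sq_le k.+1 K isT h; lra.
have /Rabs_lt_between := h1 k ltac:(rewrite /K in hkK; lia).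
have /Rabs_lt_between := h2 k ltac:(rewrite /K in hkK; lia).
rewrite /= -/c => b2 b1.
have q0 : 0 < INR (p k) by have := prime_ge2_R _ (enum_prime k k1); lra.
have q1 : 0 < INR (p k.+1) by have := prime_ge2_R _ (enum_prime k.+1 isT); lra.
have l1 : 2 * ln (INR (p k)) <= ln t.
  have -> : 2 * ln (INR (p k)) = ln (INR (p k) ^ 2) by rewrite ln_pow //= ; lra.
  by apply: ln_le; [apply: pow_lt|lra].
have l2 : ln t <= 2 * ln (INR (p k.+1)).
  have -> : 2 * ln (INR (p k.+1)) = ln (INR (p k.+1) ^ 2) by rewrite ln_pow //= ; lra.
  by apply: ln_le; lra.
have lt0 : 0 < ln t by rewrite -ln_1; apply: ln_increasing; lra.
have m0 : 0 < mertens_prod p k by rewrite -(prednK k1) mertens_prodE; apply: exp_pos.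
have b : Rabs (mertens_prod p k * ln t - 2 * c) <= eps * (2 * c) by apply: Rabs_le; nra.
have -> : mertens_prod p k - 2 * c * / ln t = (mertens_prod p k * ln t - 2 * c) * / ln t.
  by field; lra.
have i0 : 0 < / ln t by apply: Rinv_0_lt_compat.
rewrite Rabs_mult (Rabs_right (/ ln t)); last by lra.
by rewrite -Rmult_assoc; apply: Rmult_le_compat_r; lra.
Qed.

End Enumeration.

(** * The logarithmic integral and the final comparison *)

Lemma ex_RInt_inv_ln (a b : R) : 1 < a -> a <= b -> ex_RInt (fun t => / ln t) a b.
Proof.
move=> ha hab; apply: ex_RInt_continuous => t.
rewrite Rmin_left ?Rmax_right // => ht.
apply: (@ex_derive_continuous R_AbsRing); auto_derive; split; first by lra.
by have : 0 < ln t by [rewrite -ln_1; apply: ln_increasing; lra]; lra.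
Qed.

Lemma is_RInt_li (x y : R) : 2 <= x -> x <= y ->
  is_RInt (fun t => / ln t) x y (li y - li x).
Proof.
move=> hx hxy.
have e2 := ex_RInt_inv_ln x y ltac:(lra) hxy.
have -> : li y - li x = RInt (fun t => / ln t) x y.
  rewrite /li -(RInt_Chasles _ 2 x y) // ?/plus /=; first by lra.
  by apply: ex_RInt_inv_ln; lra.
exact: RInt_correct.
Qed.

Lemma li_ge (x : R) : 2 <= x -> ln x - ln 2 <= li x.
Proof.
move=> hx.
have h1 : is_RInt Rinv 2 x (ln x - ln 2).
  apply: (is_RInt_derive ln Rinv) => t; rewrite Rmin_left ?Rmax_right // => ht.
    by auto_derive; [lra|field; lra].
  by apply: (@ex_derive_continuous R_AbsRing); auto_derive; lra.
have h2 := RInt_correct _ _ _ (ex_RInt_inv_ln 2 x ltac:(lra) hx).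
apply: (is_RInt_le _ _ _ _ _ _ hx h1 h2) => t ht.
have lt0 : 0 < ln t by rewrite -ln_1; apply: ln_increasing; lra.
have h0 : 0 < t by lra.
by apply: Rinv_le_contravar => //; have := ln_le_sub_1 t h0; lra.
Qed.

(** An integrated form of l'Hopital's rule: the contribution of the base point [x0] is absorbed as
    [G] grows. *)
Lemma is_lim_ratio_of_increments (F G : R -> R) :
  is_lim G p_infty p_infty ->
  (forall eps, 0 < eps -> exists x0, forall x, x0 <= x ->
     Rabs (F x - F x0 - (G x - G x0)) <= eps * (G x - G x0)) ->
  is_lim (fun x => F x / G x) p_infty 1.
Proof.
move=> hG hF; apply/is_lim_spec => eps; have he := cond_pos eps.
have e2 : 0 < eps / 2 by lra.
have [x0 h0] := hF _ e2.
(* Chosen so that |F x - G x| <= eps/2 * G x + C; the threshold 2 C / eps for [G x] then makes C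
   less than eps/2 * G x. *)
pose C := Rabs (F x0) + (1 + eps / 2) * Rabs (G x0).
have C0 : 0 <= C.
  by rewrite /C; have := Rabs_pos (F x0); have := Rabs_pos (G x0); nra.
have /is_lim_spec /(_ (2 * C / eps)) [M hM] := hG.
exists (Rmax M x0) => x hx.
have hx1 := hM x (Rle_lt_trans _ _ _ (Rmax_l _ _) hx).
have /h0 /Rabs_le_between hx2 := Rlt_le _ _ (Rle_lt_trans _ _ _ (Rmax_r M x0) hx).
have g0 : 0 < G x.
  by apply: Rle_lt_trans hx1; apply: Rdiv_le_0_compat; lra.
have hC : C < eps / 2 * G x.
  apply: (Rmult_lt_reg_l (2 / eps)); first by apply: Rdiv_lt_0_compat; lra.
  have -> : 2 / eps * (eps / 2 * G x) = G x by field; lra.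
  by have -> : 2 / eps * C = 2 * C / eps by field; lra.
have -> : F x / G x - 1 = (F x - G x) * / G x by field; lra.
rewrite Rabs_mult (Rabs_right (/ G x)); last by apply: Rle_ge; apply: Rlt_le; apply: Rinv_0_lt_compat.
apply: (Rmult_lt_reg_r (G x)) => //.
rewrite Rmult_assoc Rinv_l ?Rmult_1_r; last by lra.
have /Rabs_le_between f0 := Rle_refl (Rabs (F x0)).
have /Rabs_le_between g1 := Rle_refl (Rabs (G x0)).
by apply: Rabs_def1; move: hC; rewrite /C; nra.
Qed.

Theorem theorem3p4 (p : nat -> nat) (hp : prime_enum p) :
  is_lim (fun x => pitilde p x / (2 * exp (- euler_gamma) * li x)) p_infty 1.
Proof.
have c0 : 0 < 2 * exp (- euler_gamma) by have := exp_pos (- euler_gamma); lra.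
set c := 2 * exp (- euler_gamma) in c0 *.
apply: is_lim_ratio_of_increments.
- apply: (is_lim_le_p_loc (fun x => c * (ln x - ln 2))).
    exists 2 => x hx; apply: Rmult_le_compat_l; first by lra.
    by apply: li_ge; lra.
  have h : is_lim (fun x => ln x - ln 2) p_infty p_infty.
    apply: (is_lim_minus _ _ _ p_infty (ln 2)) => //; first exact: is_lim_ln_p.
    exact: is_lim_const.
  have e : Rbar_mult c p_infty = p_infty.
    apply: is_Rbar_mult_unique; apply: is_Rbar_mult_sym.
    exact: is_Rbar_mult_p_infty_pos.
  by have := is_lim_scal_l _ c _ _ h; rewrite e.
- move=> eps he; have [x0 x4 hx0] := pi_density_lim p hp eps he.
  exists x0 => x hx; rewrite -/c in hx0.
  have i1 := is_RInt_pitilde p hp x0 x4.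
  have i2 := is_RInt_pitilde p hp x ltac:(lra).
  have i3 : is_RInt (pi_density p) x0 x (pitilde p x - pitilde p x0).
    have := is_RInt_Chasles _ _ _ _ _ _ (is_RInt_swap _ _ _ _ i1) i2.
    by congr is_RInt; rewrite /plus /opp /=; lra.
  have i4 : is_RInt (fun t => c * / ln t) x0 x (c * (li x - li x0)).
    by apply: is_RInt_scal; apply: is_RInt_li; lra.
  have i5 : is_RInt (fun t => eps * (c * / ln t)) x0 x (eps * (c * (li x - li x0))).
    exact: is_RInt_scal i4.
  (* The pointwise relative bound on the densities, integrated from [x0] to [x], is the required
     bound on increments. *)
  have := norm_RInt_le _ _ _ _ _ _ hx _ (is_RInt_minus _ _ _ _ _ _ i3 i4) i5.
  rewrite -Rmult_minus_distr_l; apply => t [ht _]; exact: hx0.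
Qed.
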